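(* Let $(M,g)$ be a locally conformally flat Riemannian manifold of even dimension $n\ge 4$. Then for every $\varphi\in C^\infty(M)$, $$n\,\frac{d}{dt}\Big|_{t=0}\Big(e^{nt\varphi}\,\mathcal T_{\frac n2-1}(e^{2t\varphi}g)\Big)=\sum_{j=1}^{\frac n2-1}j\,\big[\mathcal T_{j-1}(g),[\mathcal T_{\frac n2-1-j}(g),\varphi]\big]^0 .$$
   Context: For a Riemannian metric $g$ on a manifold of dimension $n\ge 3$ with scalar curvature $\tau$, let $\mathsf J=\tau/(2(n-1))$ and let the Schouten tensor $\mathsf P$ be defined by $(n-2)\mathsf P=\mathrm{Ric}-\mathsf J g$. A symmetric bilinear form is identified via $g$ with an endomorphism of $TM$, so powers $\mathsf P^N$ make sense (with $\mathsf P^0=g$, i.e. the identity). For a symmetric bilinear form $T$ and a $1$-form $\omega$, $T\#\omega$ is the $1$-form $X\mapsto T(\omega^\sharp,X)$. $\delta$ is the formal adjoint of $d$ (negative divergence on $1$-forms). For $N\ge0$ set $\mathcal T_N=\mathcal T_N(g)=\delta(\mathsf P^N\# d)$, a second-order operator on functions; in particular $\mathcal T_0=-\Delta$, where $\Delta$ is the Laplacian with $-\Delta\ge0$. The function $\varphi$ is regarded as a multiplication operator and $[\cdot,\cdot]$ is the commutator. For a differential operator $D$ on functions, $D^0=D-D(1)$ denotes its non-constant part ($D(1)$ acting by multiplication). *)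

(* Defs.v *)
From HB Require Import structures.
From mathcomp Require Import all_boot all_order all_algebra.
From mathcomp Require Import all_classical all_reals all_analysis.
Set Implicit Arguments.
Unset Strict Implicit.
Unset Printing Implicit Defensive.
Import Order.TTheory GRing.Theory Num.Theory.
Import numFieldNormedType.Exports.
Local Open Scope classical_set_scope.
Local Open Scope ring_scope.

(** * Calculus on open subsets of R^n; points are row vectors *)

Definition partial (R : realType) (n : nat) (i : 'I_n) (f : 'rV[R]_n -> R)
  : 'rV[R]_n -> R := fun x => 'D_(delta_mx 0 i) f x.

Definition iter_partial (R : realType) (n : nat) (s : seq 'I_n)
  (f : 'rV[R]_n -> R) : 'rV[R]_n -> R := foldr (@partial R n) f s.

(* Meant for open [U]: [differentiable] at a point of [U] is unrestricted. *)
Definition smooth_on (R : realType) (n : nat) (U : set 'rV[R]_n)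
  (f : 'rV[R]_n -> R) : Prop :=
  forall (s : seq 'I_n) (x : 'rV[R]_n), U x ->
    differentiable (iter_partial s f) x.

(** * Smooth manifolds *)

(* [coord] and [param] are mutually inverse homeomorphisms between [dom] and
   [img]; their values elsewhere are irrelevant. *)
Record chart (R : realType) (M : topologicalType) (n : nat) := Chart {
  dom : set M ;
  img : set 'rV[R]_n ;
  coord : M -> 'rV[R]_n ;
  param : 'rV[R]_n -> M ;
  dom_open : open dom ;
  img_open : open img ;
  coord_img : forall x, dom x -> img (coord x) ;
  param_dom : forall y, img y -> dom (param y) ;
  coordK : forall x, dom x -> param (coord x) = x ;
  paramK : forall y, img y -> coord (param y) = y ;
  coord_cont : forall x, dom x -> {for x, continuous coord} ;
  param_cont : forall y, img y -> {for y, continuous param} }.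

Definition transition (R : realType) (M : topologicalType) (n : nat)
  (c c' : chart R M n) : 'rV[R]_n -> 'rV[R]_n := fun y => coord c' (param c y).

Definition overlap (R : realType) (M : topologicalType) (n : nat)
  (c c' : chart R M n) : set 'rV[R]_n :=
  [set y | img c y /\ dom c' (param c y)].

Definition compatible (R : realType) (M : topologicalType) (n : nat)
  (c c' : chart R M n) : Prop :=
  forall k : 'I_n,
    smooth_on (overlap c c') (fun y => transition c c' y 0 k) /\
    smooth_on (overlap c' c) (fun y => transition c' c y 0 k).

Record smoothStructure (R : realType) (M : topologicalType) (n : nat) :=
  SmoothStructure {
  atlas : set (chart R M n) ;
  atlas_cover : forall x : M, exists c, atlas c /\ dom c x ;
  atlas_compatible : forall c c', atlas c -> atlas c' -> compatible c c' ;
  atlas_maximal :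
    forall c, (forall c', atlas c' -> compatible c c') -> atlas c }.

Definition chart_at (R : realType) (M : topologicalType) (n : nat)
  (S : smoothStructure R M n) (x : M) : chart R M n :=
  projT1 (cid (atlas_cover S x)).

Definition smooth (R : realType) (M : topologicalType) (n : nat)
  (S : smoothStructure R M n) (u : M -> R) : Prop :=
  forall c, atlas S c -> smooth_on (img c) (fun y => u (param c y)).

(** * Riemannian metrics *)

(* A metric is given by its matrices of components in charts:
   [g c y i j] is g(d_i, d_j) at the point [param c y]. *)
Definition metric (R : realType) (M : topologicalType) (n : nat) : Type :=
  chart R M n -> 'rV[R]_n -> 'M[R]_n.

(* ['J f y] acts on row vectors from the right, so its (i, k) entry is
   d_i f^k and the pullback of a bilinear form [B] is J B J^T. *)
Record riemannian (R : realType) (M : topologicalType) (n : nat)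
  (S : smoothStructure R M n) (g : metric R M n) : Prop := Riemannian {
  metric_smooth : forall c, atlas S c ->
    forall i j : 'I_n, smooth_on (img c) (fun y => g c y i j) ;
  metric_sym : forall c, atlas S c -> forall y, img c y -> (g c y)^T = g c y ;
  metric_pos : forall c, atlas S c -> forall y, img c y ->
    forall v : 'rV[R]_n, v != 0 -> 0 < (v *m g c y *m v^T) 0 0 ;
  metric_transition : forall c c', atlas S c -> atlas S c' ->
    forall y, overlap c c' y ->
      g c y = 'J (transition c c') y *m g c' (transition c c' y)
              *m ('J (transition c c') y)^T }.

(* The metric e^{2 f} g. *)
Definition conformal_change (R : realType) (M : topologicalType) (n : nat)
  (f : M -> R) (g : metric R M n) : metric R M n :=
  fun c y => expR (2 * f (param c y)) *: g c y.

Definition locally_conformally_flat (R : realType) (M : topologicalType)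
  (n : nat) (S : smoothStructure R M n) (g : metric R M n) : Prop :=
  forall x : M, exists c : chart R M n,
    [/\ atlas S c, dom c x &
      exists s : 'rV[R]_n -> R, smooth_on (img c) s /\
        forall y, img c y -> g c y = expR (2 * s y) *: 1%:M].

(** * Curvature and the operators T_N in coordinates

    Here [G] is the matrix field of components of a metric. *)

Definition christoffel (R : realType) (n : nat) (G : 'rV[R]_n -> 'M[R]_n)
  (k i j : 'I_n) : 'rV[R]_n -> R := fun x =>
  2^-1 * \sum_(l < n) invmx (G x) k l *
    (partial i (fun y => G y j l) x + partial j (fun y => G y i l) x
     - partial l (fun y => G y i j) x).

(* R(d_i, d_j) d_k = sum_l (riemann G l k i j) d_l, where
   R(X, Y) = [D_X, D_Y] - D_[X, Y]. *)
Definition riemann (R : realType) (n : nat) (G : 'rV[R]_n -> 'M[R]_n)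
  (l k i j : 'I_n) : 'rV[R]_n -> R := fun x =>
  partial i (christoffel G l j k) x - partial j (christoffel G l i k) x
  + \sum_(m < n) (christoffel G l i m x * christoffel G m j k x
                  - christoffel G l j m x * christoffel G m i k x).

(* Positive on round spheres. *)
Definition ricci (R : realType) (n : nat) (G : 'rV[R]_n -> 'M[R]_n)
  (x : 'rV[R]_n) : 'M[R]_n :=
  \matrix_(k, j) \sum_(i < n) riemann G i k i j x.

Definition scalar_curvature (R : realType) (n : nat)
  (G : 'rV[R]_n -> 'M[R]_n) (x : 'rV[R]_n) : R :=
  \tr (invmx (G x) *m ricci G x).

Definition schouten_trace (R : realType) (n : nat) (G : 'rV[R]_n -> 'M[R]_n)
  (x : 'rV[R]_n) : R :=
  scalar_curvature G x / (2 * (n%:R - 1)).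

Definition schouten (R : realType) (n : nat) (G : 'rV[R]_n -> 'M[R]_n)
  (x : 'rV[R]_n) : 'M[R]_n :=
  (n%:R - 2)^-1 *: (ricci G x - schouten_trace G x *: G x).

(* The power P^N as a bilinear form: the endomorphism attached to P is G^-1 P
   (acting on column vectors), and P^0 = G. *)
Definition schouten_pow (R : realType) (n : nat) (G : 'rV[R]_n -> 'M[R]_n)
  (N : nat) (x : 'rV[R]_n) : 'M[R]_n :=
  G x *m (invmx (G x) *m schouten G x) ^+ N.

Definition ext_diff (R : realType) (n : nat) (u : 'rV[R]_n -> R)
  (x : 'rV[R]_n) : 'rV[R]_n := \row_i partial i u x.

Definition sharp (R : realType) (n : nat) (G : 'M[R]_n) (w : 'rV[R]_n)
  : 'rV[R]_n := w *m invmx G.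

(* T # w, the 1-form X |-> T(w^sharp, X). *)
Definition hash (R : realType) (n : nat) (G : 'M[R]_n) (T : 'M[R]_n)
  (w : 'rV[R]_n) : 'rV[R]_n := sharp G w *m T.

(* Minus the divergence, - sum_ij g^ij (D_i w)_j, D the Levi-Civita
   connection. *)
Definition codiff (R : realType) (n : nat) (G : 'rV[R]_n -> 'M[R]_n)
  (w : 'rV[R]_n -> 'rV[R]_n) (x : 'rV[R]_n) : R :=
  - \sum_(i < n) \sum_(j < n) invmx (G x) i j *
      (partial i (fun y => w y 0 j) x
       - \sum_(k < n) christoffel G k i j x * w x 0 k).

Definition local_T_op (R : realType) (n : nat) (N : nat)
  (G : 'rV[R]_n -> 'M[R]_n) (u : 'rV[R]_n -> R) : 'rV[R]_n -> R :=
  codiff G (fun y => hash (G y) (schouten_pow G N y) (ext_diff u y)).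

(** * Operators on functions on M *)

(* T_N(g); the value at [x] is computed in a chart around [x]. *)
Definition T_op (R : realType) (M : topologicalType) (n : nat)
  (S : smoothStructure R M n) (N : nat) (g : metric R M n)
  (u : M -> R) : M -> R := fun x =>
  let c := chart_at S x in
  local_T_op N (g c) (fun y => u (param c y)) (coord c x).

Definition mul_op (R : realType) (M : Type) (f : M -> R)
  (u : M -> R) : M -> R := fun x => f x * u x.

Definition comm_op (R : realType) (M : Type) (A B : (M -> R) -> (M -> R))
  (u : M -> R) : M -> R := fun x => A (B u) x - B (A u) x.

(* The non-constant part D - D(1). *)
Definition nonconst_op (R : realType) (M : Type) (D : (M -> R) -> (M -> R))
  (u : M -> R) : M -> R := fun x => D u x - D (fun=> 1) x * u x.

(* Main.v *)
Require Import Defs.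
From HB Require Import structures.
From mathcomp Require Import all_boot all_order all_algebra.
From mathcomp Require Import all_classical all_reals all_analysis.
From mathcomp Require Import ring lra zify.
Set Implicit Arguments.
Unset Strict Implicit.
Unset Printing Implicit Defensive.
Import Order.TTheory GRing.Theory Num.Theory.
Import numFieldNormedType.Exports.
Local Open Scope classical_set_scope.
Local Open Scope ring_scope.

(** Both sides are computed in a chart where the metric is
    [expR (2 * s) *: 1%:M].  This is legitimate because the operators [T_N] are
    built naturally from the metric: Christoffel matrices, curvature, powers of
    the Schouten tensor and codifferential all transform correctly under a
    change of coordinates ([local_T_op_change]).

    In such a chart the Schouten tensor is the explicit matrix
    [P = ds^T ds - hess s - |ds|^2 / 2], and [T_N] is minus the divergence of
    [du *m alpha s N], with [alpha s N = expR (- 2 * N.+1 * s) *: P ^+ N], for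
    the volume form [expR (n * s)] ([flat_T_op]).  When [n = 2 * M.+1] and
    [N = M] the exponentials cancel and [expR (n * s)] times [T_M u] is minus
    the Euclidean divergence of [du *m P ^+ M] ([wlap_top]).  Replacing [s] by
    [s + t * phi] changes [P] into [P + t *: Q + O(t^2)], where [Q] is minus
    the Hessian of [phi] for the metric; hence the derivative on the left is,
    up to the density, minus the divergence of
    [du *m \sum_(a + b = M - 1) P ^+ a *m Q *m P ^+ b] ([is_derive_flux]).

    On the right, each [T_N] is symmetric for the volume form and kills
    constants.  A double commutator of two such operators with a function is
    symmetric too, of second order, and so its non-constant part is the
    divergence of a symmetric tensor applied to [du], which can be read off from
    the principal symbol: up to a constant factor, it is the Lie derivative of
    [alpha s L] along the vector field [dphi *m alpha s N]
    ([double_commutator]).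

    It remains to sum these Lie derivatives with weights [L + 1] over
    [L + N = M - 1].  Lie derivatives may be computed with covariant instead of
    partial derivatives ([lie_alphaE]).  The second derivatives of [phi] give
    [P ^+ L *m Q *m P ^+ N + P ^+ N *m Q *m P ^+ L], whose weighted sum has the
    constant weight [M + 1 = n / 2].  The first derivatives of [P] enter through
    [C (P ^+ p v, P ^+ q _, P ^+ r _)] with [p + q + r = M - 2], where [C] is the
    covariant derivative of [P]; by the Codazzi equation [C] is totally symmetric
    ([cotton_codazzi]), and then the weights cancel ([cubic_cancellation]). *)

(** * Calculus on open subsets of Euclidean space *)

Section Calculus.
Variable (R : realType).

Lemma partialD n (i : 'I_n) (f g : 'rV[R]_n -> R) x :
  differentiable f x -> differentiable g x ->
  partial i (fun y => f y + g y) x = partial i f x + partial i g x.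
Proof. by move=> df dg; apply: deriveD; exact: diff_derivable. Qed.

Lemma partialN n (i : 'I_n) (f : 'rV[R]_n -> R) x :
  differentiable f x -> partial i (fun y => - f y) x = - partial i f x.
Proof. by move=> df; apply: deriveN; exact: diff_derivable. Qed.

Lemma partialM n (i : 'I_n) (f g : 'rV[R]_n -> R) x :
  differentiable f x -> differentiable g x ->
  partial i (fun y => f y * g y) x = partial i f x * g x + f x * partial i g x.
Proof.
move=> df dg; rewrite /partial.
by rewrite [LHS]deriveM; [rewrite addrC mulrC | exact: diff_derivable..].
Qed.

Lemma partial_cst n (i : 'I_n) (c : R) x :
  partial i (fun=> c : R) (x : 'rV[R]_n) = 0.
Proof. exact: derive_cst. Qed.

Lemma differentiable_expR (f : R) : differentiable (@expR R) f.
Proof. by apply/derivable1_diffP. Qed.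

Lemma partial_exp n (i : 'I_n) (f : 'rV[R]_n -> R) x :
  differentiable f x ->
  partial i (fun y => expR (f y)) x = expR (f x) * partial i f x.
Proof.
move=> df; rewrite /partial deriveE; last first.
  by apply: differentiable_comp => //; exact: differentiable_expR.
rewrite (diff_comp (f := f) (g := @expR R)) //; last exact: differentiable_expR.
rewrite deriveE //= mulrC.
have := deriv1E (@derivable_expR R (f x)) => ->.
by rewrite /= derive1E derive_val.
Qed.

Lemma partial_ext n (U : set 'rV[R]_n) (i : 'I_n) (f g : 'rV[R]_n -> R) :
  open U -> (forall x, U x -> f x = g x) ->
  forall x, U x -> partial i f x = partial i g x.
Proof.
move=> oU fg x Ux; apply: near_eq_derive.
by near do apply: fg; exact: open_nbhs_nbhs.
Unshelve. all: by end_near. Qed.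

Lemma differentiable_near0 (V : normedModType R) (k : V -> R) (x : V) :
  (\forall y \near x, k y = 0) -> differentiable k x.
Proof.
move=> k0.
have kx : k x = 0 by exact: nbhs_singleton k0.
have H : k \o shift x = cst (k x) + (\0 : V -> R) +o_ 0 id.
  apply/eqaddoP => e e0; rewrite kx /=.
  near=> h; rewrite !fctE /= addr0 subr0.
  have -> : k (h + x) = 0.
    near: h.
    have := k0; rewrite (near_shift 0 x) /=.
    by apply: filterS => h; rewrite subr0.
  by rewrite normr0 mulr_ge0 // ltW.
have c0 : continuous (\0 : V -> R) by exact: cst_continuous.
apply/diff_locallyP; rewrite (diff_unique c0 H); split => //.
Unshelve. all: by end_near. Qed.

Lemma differentiable_ext n (U : set 'rV[R]_n) (f g : 'rV[R]_n -> R) :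
  open U -> (forall x, U x -> f x = g x) ->
  forall x, U x -> differentiable f x -> differentiable g x.
Proof.
move=> oU fg x Ux df.
have -> : g = f + (g - f) by apply/funext => y; rewrite !fctE addrC subrK.
apply: differentiableD => //; apply: differentiable_near0.
by near=> y; rewrite !fctE fg ?subrr //; near: y; exact: open_nbhs_nbhs.
Unshelve. all: by end_near. Qed.

Lemma differentiable_components m n (psi : 'rV[R]_m -> 'rV[R]_n) x :
  (forall k, differentiable (fun y => psi y 0 k) x) -> differentiable psi x.
Proof.
move=> dpsi.
have -> : psi = \sum_(k < n) (fun y => psi y 0 k *: delta_mx 0 k).
  apply/funext => y; rewrite fct_sumE.
  exact: row_sum_delta.
apply: differentiable_sum => k.
exact: differentiableZl.
Qed.

Lemma partial_comp m n (i : 'I_m) (psi : 'rV[R]_m -> 'rV[R]_n) f x :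
  (forall k, differentiable (fun y => psi y 0 k) x) ->
  differentiable f (psi x) ->
  partial i (fun y => f (psi y)) x =
  \sum_(k < n) partial i (fun y => psi y 0 k) x * partial k f (psi x).
Proof.
move=> dpsi df; have dp := differentiable_components dpsi.
rewrite /partial deriveE; last exact: differentiable_comp.
rewrite (diff_comp (f := psi) (g := f)) //= -[X in 'd f _ X]/('d psi x _).
rewrite -(deriveE (delta_mx 0 i) dp) derive_mx; last exact: diff_derivable.
rewrite [X in 'd f _ X]row_sum_delta linear_sum; apply: eq_bigr => k _.
by rewrite linearZ /= mxE -deriveE.
Qed.

Lemma iter_partial_ext n (U : set 'rV[R]_n) s (f g : 'rV[R]_n -> R) :
  open U -> (forall x, U x -> f x = g x) ->
  forall x, U x -> iter_partial s f x = iter_partial s g x.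
Proof.
move=> oU fg; elim: s => [|i s IH] x Ux; first exact: fg.
exact: (partial_ext i oU IH).
Qed.

(** Smoothness is coinductive: a family of functions that are differentiable
    on [U] and is stable under partial derivatives, up to equality on [U],
    consists of smooth functions. *)
Lemma smooth_on_bisim n (U : set 'rV[R]_n) (Q : ('rV[R]_n -> R) -> Prop) :
  open U ->
  (forall f, Q f -> forall x, U x -> differentiable f x) ->
  (forall f i, Q f ->
     exists f', Q f' /\ forall x, U x -> partial i f x = f' x) ->
  forall f, Q f -> smooth_on U f.
Proof.
move=> oU Qd Qp f Qf s; elim/last_ind: s f Qf => [|s i IH] f Qf x Ux.
  exact: Qd.
have [f' [Qf' e]] := Qp f i Qf.
rewrite /iter_partial foldr_rcons -/(iter_partial _ _).
apply: (differentiable_ext oU (f := iter_partial s f')) => // [z Uz|].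
  by apply: (iter_partial_ext s oU _ Uz) => y Uy; rewrite e.
exact: IH.
Qed.

Lemma smooth_diff n (U : set 'rV[R]_n) f x :
  smooth_on U f -> U x -> differentiable f x.
Proof. by move=> sf; exact: (sf [::]). Qed.

Lemma smooth_partial n (U : set 'rV[R]_n) f i :
  smooth_on U f -> smooth_on U (partial i f).
Proof.
move=> sf s x Ux; have := sf (rcons s i) x Ux.
by rewrite /iter_partial foldr_rcons.
Qed.

Lemma smooth_ext n (U : set 'rV[R]_n) f g : open U ->
  (forall x, U x -> f x = g x) -> smooth_on U f -> smooth_on U g.
Proof.
move=> oU fg sf s x Ux; apply: (differentiable_ext oU _ Ux (sf s x Ux)).
exact: iter_partial_ext.
Qed.

(** The expressions built from smooth functions by the ring operations,
    exponentials and smooth changes of variables form a family to which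
    [smooth_on_bisim] applies, which gives all closure properties at once. *)
Inductive smooth_term n (U : set 'rV[R]_n) : ('rV[R]_n -> R) -> Prop :=
| Smooth_base f : smooth_on U f -> smooth_term U f
| Smooth_cst c : smooth_term U (fun=> c)
| Smooth_add f g : smooth_term U f -> smooth_term U g ->
    smooth_term U (fun x => f x + g x)
| Smooth_mul f g : smooth_term U f -> smooth_term U g ->
    smooth_term U (fun x => f x * g x)
| Smooth_exp f : smooth_term U f -> smooth_term U (fun x => expR (f x))
| Smooth_comp p (V : set 'rV[R]_p) (psi : 'rV[R]_n -> 'rV[R]_p) f :
    (forall x, U x -> V (psi x)) ->
    (forall k, smooth_on U (fun x => psi x 0 k)) -> smooth_on V f ->
    smooth_term U (fun x => f (psi x)).

Lemma smooth_term_diff n (U : set 'rV[R]_n) f x :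
  smooth_term U f -> U x -> differentiable f x.
Proof.
move=> + Ux; elim=> {f} [f sf|c|f g _ df _ dg|f g _ df _ dg|f _ df|
  p V psi f UV spsi sf].
- exact: smooth_diff sf Ux.
- exact: differentiable_cst.
- exact: differentiableD.
- exact: differentiableM.
- by apply: (differentiable_comp df); exact: differentiable_expR.
- apply: differentiable_comp; last exact: smooth_diff sf (UV _ Ux).
  by apply: differentiable_components => k; exact: smooth_diff (spsi k) Ux.
Qed.

Lemma smooth_term_sum n (U : set 'rV[R]_n) (I : Type) (r : seq I)
    (F : I -> 'rV[R]_n -> R) :
  (forall i, smooth_term U (F i)) ->
  smooth_term U (fun x => \sum_(i <- r) F i x).
Proof.
move=> sF; elim: r => [|i r IH].
  have -> : (fun x => \sum_(i <- [::]) F i x) = (fun=> 0).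
    by apply/funext => x; rewrite big_nil.
  exact: Smooth_cst.
have -> : (fun x => \sum_(j <- i :: r) F j x) =
    (fun x => F i x + \sum_(j <- r) F j x).
  by apply/funext => x; rewrite big_cons.
exact: Smooth_add.
Qed.

Lemma smooth_term_partial n (U : set 'rV[R]_n) f i :
  smooth_term U f ->
  exists f', smooth_term U f' /\ forall x, U x -> partial i f x = f' x.
Proof.
have D := @smooth_term_diff n U.
elim=> {f} [f sf|c|f g sf [f' [sf' ef]] sg [g' [sg' eg]]
  |f g sf [f' [sf' ef]] sg [g' [sg' eg]]|f sf [f' [sf' ef]]|
  p V psi f UV spsi sf].
- by exists (partial i f); split=> //; apply/Smooth_base/smooth_partial.
- exists (fun=> 0); split; first exact: Smooth_cst.
  by move=> x Ux; rewrite partial_cst.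
- exists (fun x => f' x + g' x); split; first exact: Smooth_add.
  by move=> x Ux; rewrite partialD ?ef ?eg //; exact: D.
- exists (fun x => f' x * g x + f x * g' x); split.
    by apply: Smooth_add; exact: Smooth_mul.
  by move=> x Ux; rewrite partialM ?ef ?eg //; exact: D.
- exists (fun x => expR (f x) * f' x); split.
    by apply: Smooth_mul => //; exact: Smooth_exp.
  by move=> x Ux; rewrite partial_exp ?ef //; exact: D.
- exists (fun x => \sum_(k < p) partial i (fun y => psi y 0 k) x *
                                partial k f (psi x)); split.
    apply: smooth_term_sum => k; apply: Smooth_mul.
      exact/Smooth_base/smooth_partial.
    by apply: (Smooth_comp UV spsi); exact: smooth_partial.
  move=> x Ux; apply: partial_comp; last exact: smooth_diff sf (UV _ Ux).
  by move=> k; exact: smooth_diff (spsi k) Ux.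
Qed.

Lemma smooth_term_smooth n (U : set 'rV[R]_n) f :
  open U -> smooth_term U f -> smooth_on U f.
Proof.
move=> oU; apply: (smooth_on_bisim oU) => // {}f.
  by move=> sf x; exact: smooth_term_diff.
by move=> i; exact: smooth_term_partial.
Qed.

Section Closure.
Variables (n : nat) (U : set 'rV[R]_n).
Hypothesis oU : open U.
Implicit Types f g : 'rV[R]_n -> R.

Lemma smooth_cst c : smooth_on U (fun=> c).
Proof. exact/smooth_term_smooth/Smooth_cst. Qed.

Lemma smoothD f g : smooth_on U f -> smooth_on U g ->
  smooth_on U (fun x => f x + g x).
Proof.
by move=> sf sg; apply/smooth_term_smooth/Smooth_add; rewrite //; exact: Smooth_base.
Qed.

Lemma smoothM f g : smooth_on U f -> smooth_on U g ->
  smooth_on U (fun x => f x * g x).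
Proof.
by move=> sf sg; apply/smooth_term_smooth/Smooth_mul; rewrite //; exact: Smooth_base.
Qed.

Lemma smooth_exp f : smooth_on U f -> smooth_on U (fun x => expR (f x)).
Proof.
by move=> sf; apply/smooth_term_smooth/Smooth_exp; rewrite //; exact: Smooth_base.
Qed.

Lemma smoothN f : smooth_on U f -> smooth_on U (fun x => - f x).
Proof.
move=> sf; apply: (smooth_ext oU (f := fun x => (-1) * f x)).
  by move=> x _; rewrite mulN1r.
by apply: smoothM => //; exact: smooth_cst.
Qed.

Lemma smoothB f g : smooth_on U f -> smooth_on U g ->
  smooth_on U (fun x => f x - g x).
Proof. by move=> sf sg; apply: smoothD => //; exact: smoothN. Qed.

Lemma smooth_sum (I : Type) (r : seq I) (F : I -> 'rV[R]_n -> R) :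
  (forall i, smooth_on U (F i)) -> smooth_on U (fun x => \sum_(i <- r) F i x).
Proof.
move=> sF; apply/smooth_term_smooth/smooth_term_sum => // i.
exact: Smooth_base.
Qed.

Lemma smooth_comp p (V : set 'rV[R]_p) (psi : 'rV[R]_n -> 'rV[R]_p) h :
  (forall x, U x -> V (psi x)) ->
  (forall k, smooth_on U (fun x => psi x 0 k)) -> smooth_on V h ->
  smooth_on U (fun x => h (psi x)).
Proof. by move=> UV sp sf; apply/smooth_term_smooth => //; exact: Smooth_comp sf. Qed.

Lemma partial_sum (I : Type) (r : seq I) (F : I -> 'rV[R]_n -> R) i x :
  U x -> (forall k, smooth_on U (F k)) ->
  partial i (fun y => \sum_(k <- r) F k y) x =
  \sum_(k <- r) partial i (F k) x.
Proof.
move=> Ux sF; elim: r => [|k r IH].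
  rewrite big_nil (_ : (fun _ => _) = fun=> 0) ?partial_cst //.
  by apply/funext => y; rewrite big_nil.
rewrite big_cons -IH -partialD.
- by congr (partial i _ x); apply/funext => y; rewrite big_cons.
- exact: smooth_diff (sF k) Ux.
- by apply: (smooth_diff (U := U)) => //; exact: smooth_sum.
Qed.

End Closure.

Lemma is_derive_line n (f : 'rV[R]_n -> R) (v z : 'rV[R]_n) (s : R) :
  differentiable f (s *: v + z) ->
  is_derive s 1 (fun r : R => f (r *: v + z)) ('D_v f (s *: v + z)).
Proof.
move=> df.
have e : (fun h : R => h^-1 *: (((fun r : R => f (r *: v + z)) \o shift s) (h *: 1)
            - f (s *: v + z))) =
         (fun h => h^-1 *: ((f \o shift (s *: v + z)) (h *: v) - f (s *: v + z))).
  apply/funext => h /=; rewrite [h *: 1]mulr1 scalerDl addrA.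
  by [].
have := diff_derivable (v := v) df; rewrite /derivable => dv.
by split; rewrite /derivable /derive e.
Qed.

(** The second difference quotient of [f] along two directions, which is
    symmetric in them, tends to each iterated derivative by the mean value
    theorem applied in one direction and differentiability of the derivative
    in the other. *)
Lemma second_difference n (f : 'rV[R]_n -> R) (v w x : 'rV[R]_n) :
  (\forall y \near x, differentiable f y) -> differentiable ('D_v f) x ->
  forall e, 0 < e -> \forall t \near 0^'+,
    `|f (t *: v + (t *: w + x)) - f (t *: v + x) - f (t *: w + x) + f x
      - t ^+ 2 * 'D_w ('D_v f) x| <= e * t ^+ 2.
Proof.
move=> df dg e e0; set g := 'D_v f.
pose c := `|v| + `|w| + 1.
have c0 : 0 < c by rewrite /c ltr_wpDl // addr_ge0.
pose e' := e / (c + c).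
have e'0 : 0 < e' by rewrite divr_gt0 // addr_gt0.
have [d /= d0 Hd] : exists2 d : R, 0 < d & forall h : 'rV[R]_n, `|h| < d ->
    differentiable f (h + x) /\ `|g (h + x) - g x - 'd g x h| <= e' * `|h|.
  have /eqaddoP/(_ e' e'0) H1 := diff_locally dg.
  have H2 : \forall h \near (0 : 'rV[R]_n), differentiable f (h + x).
    by move: df; rewrite (near_shift 0 x) /=; apply: filterS => h; rewrite subr0.
  have : \forall h \near (0 : 'rV[R]_n), differentiable f (h + x) /\
      `|g (h + x) - g x - 'd g x h| <= e' * `|h|.
    apply: filterS2 H2 H1 => h ?; rewrite !fctE /= opprD addrA.
    by split.
  move=> /nbhs_ballP [d d0 H]; exists d => // h hd; apply: H.
  by rewrite -ball_normE /= sub0r normrN.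
near=> t.
have t0 : 0 < t by [].
have td : t * c < d.
  by rewrite -ltr_pdivlMr //; near: t; apply: nbhs_right_lt; rewrite divr_gt0.
have small s r : 0 <= s <= t -> 0 <= r <= t -> `|s *: v + r *: w| <= t * c.
  move=> /andP[s0 st] /andP[r0 rt].
  rewrite (le_trans (ler_normD _ _)) // !normrZ !ger0_norm // /c.
  rewrite mulrDr mulr1 mulrDr -addrA lerD //; first by rewrite ler_wpM2r.
  by rewrite -[leLHS]addr0; apply: lerD; [exact: ler_wpM2r | exact: ltW].
have d1 s r : 0 <= s <= t -> 0 <= r <= t -> differentiable f (s *: v + (r *: w + x)).
  by move=> s0 r0; rewrite addrA; apply: (Hd _ _).1; apply: le_lt_trans td; exact: small.
have t00 : 0 <= (0:R) <= t by rewrite lexx ltW.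
have tt0 : 0 <= t <= t by rewrite lexx ltW.
have d2 s : 0 <= s <= t -> differentiable f (s *: v + x).
  by move=> s0; have := d1 s 0 s0 t00; rewrite scale0r add0r.
pose k s := f (s *: v + (t *: w + x)) - f (s *: v + x).
pose k' s := g (s *: v + (t *: w + x)) - g (s *: v + x).
have dk s : 0 <= s <= t -> is_derive s 1 k (k' s).
  move=> s0; apply: is_deriveB; apply: is_derive_line; [exact: d1|exact: d2].
have [xi xit kt] : exists2 xi, xi \in `]0, t[ & k t - k 0 = k' xi * (t - 0).
  apply: MVT => //.
    by move=> s; rewrite in_itv /= => /andP[/ltW s0 /ltW st]; apply: dk; rewrite s0.
  apply: derivable_within_continuous => s; rewrite in_itv /= => s0.
  by have [] := dk _ s0.
have xi0 : 0 <= xi <= t by move: xit; rewrite in_itv /= => /andP[/ltW -> /ltW ->].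
have -> : f (t *: v + (t *: w + x)) - f (t *: v + x) - f (t *: w + x) + f x =
   k t - k 0.
  by rewrite /k !scale0r !add0r; ring.
rewrite kt subr0 -/g.
have -> : 'D_w g x = 'd g x w by rewrite deriveE.
have -> : k' xi * t - t ^+ 2 * 'd g x w = t * (
    (g (xi *: v + t *: w + x) - g x - 'd g x (xi *: v + t *: w))
    - (g (xi *: v + x) - g x - 'd g x (xi *: v))).
  have dZ r z : 'd g x (r *: z) = r * 'd g x z by rewrite linearZ.
  by rewrite /k' linearD !dZ addrA; ring.
rewrite normrM gtr0_norm // expr2 mulrCA; apply: ler_wpM2l; first exact: ltW.
apply: le_trans (ler_normB _ _) _.
have n1 := small _ _ xi0 tt0.
have n2 : `|xi *: v| <= t * c by have := small _ 0 xi0 t00; rewrite scale0r addr0.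
have -> : e * t = e' * (t * c) + e' * (t * c).
  by rewrite /e'; field; rewrite gt_eqF // addr_gt0.
by apply: lerD; (apply: le_trans (Hd _ _).2 _; first exact: le_lt_trans td);
  apply: ler_wpM2l => //; exact: ltW.
Unshelve. all: by end_near. Qed.

Lemma partialC n (U : set 'rV[R]_n) (f : 'rV[R]_n -> R) i j x :
  open U -> smooth_on U f -> U x ->
  partial i (partial j f) x = partial j (partial i f) x.
Proof.
move=> oU sf Ux.
have df : \forall y \near x, differentiable f y.
  by near=> y; apply: (smooth_diff sf); near: y; exact: open_nbhs_nbhs.
have dp k : differentiable (partial k f) x.
  exact: smooth_diff (smooth_partial k sf) Ux.
apply/eqP; rewrite -subr_eq0 -normr_eq0 eq_le normr_ge0 andbT.
apply/ler_addgt0Pr => e e0; rewrite add0r.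
have e20 : 0 < e / 2 by rewrite divr_gt0.
have [t [t0 H1 H2]] : exists t : R, [/\ 0 < t,
  `|f (t *: delta_mx 0 j + (t *: delta_mx 0 i + x)) - f (t *: delta_mx 0 j + x)
    - f (t *: delta_mx 0 i + x) + f x - t ^+ 2 * partial i (partial j f) x|
    <= e / 2 * t ^+ 2 &
  `|f (t *: delta_mx 0 i + (t *: delta_mx 0 j + x)) - f (t *: delta_mx 0 i + x)
    - f (t *: delta_mx 0 j + x) + f x - t ^+ 2 * partial j (partial i f) x|
    <= e / 2 * t ^+ 2].
  have D1 := second_difference (delta_mx 0 i) df (dp j) e20.
  have D2 := second_difference (delta_mx 0 j) df (dp i) e20.
  have D3 := nbhs_right_gt (0 : R).
  have [t [[E1 E2] E3]] := filter_ex (filterI (filterI D1 D2) D3).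
  exists t; split; [exact: E3|exact: E1|exact: E2].
have t2 : 0 < t ^+ 2 by rewrite exprn_gt0.
rewrite -(ler_pM2r t2) [e in leRHS]splitr mulrDl.
rewrite -[X in _ * X <= _](gtr0_norm t2) -normrM.
apply: (le_trans _ (lerD H1 H2)); rewrite -[X in _ <= X + _]normrN.
apply: le_trans (ler_normD _ _) => {H1 H2}.
rewrite (addrCA (t *: delta_mx 0 j)) le_eqVlt; apply/orP; left; apply/eqP.
move: (partial i _ x) (partial j _ x) (f x) (t ^+ 2) => p q c r.
move: (f (_ + x)) (f (_ + x)) (f (_ + (_ + x))) => a b d.
by congr `| _ |; ring.
Unshelve. all: by end_near. Qed.
End Calculus.

(* Unfolding partial derivatives down to limits makes unification diverge. *)
Opaque partial.

(** * Matrix fields *)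

Section MatrixFields.
Variables (R : realType) (n : nat) (U : set 'rV[R]_n).
Hypothesis oU : open U.

Definition mx_partial p q (i : 'I_n) (A : 'rV[R]_n -> 'M[R]_(p, q))
  (x : 'rV[R]_n) : 'M[R]_(p, q) := \matrix_(a, b) partial i (fun y => A y a b) x.

Lemma mx_partialE p q i (A : 'rV[R]_n -> 'M[R]_(p, q)) x a b :
  mx_partial i A x a b = partial i (fun y => A y a b) x.
Proof. by rewrite mxE. Qed.

Definition smooth_mx p q (A : 'rV[R]_n -> 'M[R]_(p, q)) : Prop :=
  forall a b, smooth_on U (fun y => A y a b).

Lemma smooth_mx_ext p q (A B : 'rV[R]_n -> 'M[R]_(p, q)) :
  (forall x, U x -> A x = B x) -> smooth_mx A -> smooth_mx B.
Proof.
by move=> AB sA a b; apply: (smooth_ext oU _ (sA a b)) => x Ux; rewrite AB.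
Qed.

Lemma smooth_mx_partial p q (A : 'rV[R]_n -> 'M[R]_(p, q)) i :
  smooth_mx A -> smooth_mx (mx_partial i A).
Proof.
move=> sA a b; apply: (smooth_ext oU _ (smooth_partial i (sA a b))) => x _.
by rewrite mxE.
Qed.

Lemma smooth_mx_cst p q (C : 'M[R]_(p, q)) : smooth_mx (fun=> C).
Proof. by move=> a b; exact: smooth_cst. Qed.

Lemma smooth_mxD p q (A B : 'rV[R]_n -> 'M[R]_(p, q)) :
  smooth_mx A -> smooth_mx B -> smooth_mx (fun x => A x + B x).
Proof.
move=> sA sB a b; apply: (smooth_ext oU _ (smoothD oU (sA a b) (sB a b))).
by move=> x _; rewrite mxE.
Qed.

Lemma smooth_mxN p q (A : 'rV[R]_n -> 'M[R]_(p, q)) :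
  smooth_mx A -> smooth_mx (fun x => - A x).
Proof.
move=> sA a b; apply: (smooth_ext oU _ (smoothN oU (sA a b))).
by move=> x _; rewrite mxE.
Qed.

Lemma smooth_mxM p q r (A : 'rV[R]_n -> 'M[R]_(p, q))
    (B : 'rV[R]_n -> 'M[R]_(q, r)) :
  smooth_mx A -> smooth_mx B -> smooth_mx (fun x => A x *m B x).
Proof.
move=> sA sB a b; apply: (smooth_ext oU (f := fun x => \sum_k A x a k * B x k b)).
  by move=> x _; rewrite mxE.
by apply: smooth_sum => // k; exact: smoothM.
Qed.

Lemma smooth_mxZ p q f (A : 'rV[R]_n -> 'M[R]_(p, q)) :
  smooth_on U f -> smooth_mx A -> smooth_mx (fun x => f x *: A x).
Proof.
move=> sf sA a b; apply: (smooth_ext oU _ (smoothM oU sf (sA a b))).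
by move=> x _; rewrite mxE.
Qed.

Lemma smooth_mx_tr p q (A : 'rV[R]_n -> 'M[R]_(p, q)) :
  smooth_mx A -> smooth_mx (fun x => (A x)^T).
Proof.
by move=> sA a b; apply: (smooth_ext oU _ (sA b a)) => x _; rewrite mxE.
Qed.

Lemma smooth_mx_sum p q (I : Type) (r : seq I) (F : I -> 'rV[R]_n -> 'M[R]_(p, q)) :
  (forall i, smooth_mx (F i)) -> smooth_mx (fun x => \sum_(i <- r) F i x).
Proof.
move=> sF a b.
apply: (smooth_ext oU (f := fun x => \sum_(i <- r) F i x a b)).
  by move=> x _; rewrite summxE.
by apply: smooth_sum => // k; exact: sF.
Qed.

Lemma smooth_mxX p (A : 'rV[R]_n -> 'M[R]_p) N :
  smooth_mx A -> smooth_mx (fun x => A x ^+ N).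
Proof.
move=> sA; elim: N => [|N IH]; first exact: smooth_mx_cst.
apply: (smooth_mx_ext (A := fun x => A x *m A x ^+ N)).
  by move=> x _; rewrite exprS.
exact: smooth_mxM.
Qed.

Section Rules.
Variables (i : 'I_n) (x : 'rV[R]_n).
Hypothesis Ux : U x.

Lemma mx_partial_ext p q (A B : 'rV[R]_n -> 'M[R]_(p, q)) :
  (forall y, U y -> A y = B y) -> mx_partial i A x = mx_partial i B x.
Proof.
move=> AB; apply/matrixP => a b; rewrite !mxE.
by apply: (partial_ext i oU) => // y Uy; rewrite AB.
Qed.

Lemma mx_partial_cst p q (C : 'M[R]_(p, q)) : mx_partial i (fun=> C) x = 0.
Proof. by apply/matrixP => a b; rewrite !mxE partial_cst. Qed.

Lemma mx_partialD p q (A B : 'rV[R]_n -> 'M[R]_(p, q)) :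
  smooth_mx A -> smooth_mx B ->
  mx_partial i (fun y => A y + B y) x = mx_partial i A x + mx_partial i B x.
Proof.
move=> sA sB; apply/matrixP => a b; rewrite !mxE.
rewrite -partialD; [|exact: smooth_diff (sA a b) Ux|exact: smooth_diff (sB a b) Ux].
by congr (partial i _ x); apply/funext => y; rewrite mxE.
Qed.

Lemma mx_partialN p q (A : 'rV[R]_n -> 'M[R]_(p, q)) :
  smooth_mx A -> mx_partial i (fun y => - A y) x = - mx_partial i A x.
Proof.
move=> sA; apply/matrixP => a b; rewrite !mxE.
rewrite -partialN; [|exact: smooth_diff (sA a b) Ux].
by congr (partial i _ x); apply/funext => y; rewrite mxE.
Qed.

Lemma mx_partialM p q r (A : 'rV[R]_n -> 'M[R]_(p, q))
    (B : 'rV[R]_n -> 'M[R]_(q, r)) :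
  smooth_mx A -> smooth_mx B ->
  mx_partial i (fun y => A y *m B y) x =
  mx_partial i A x *m B x + A x *m mx_partial i B x.
Proof.
move=> sA sB; apply/matrixP => a b; rewrite !mxE.
transitivity (partial i (fun y => \sum_k A y a k * B y k b) x).
  by congr (partial i _ x); apply/funext => y; rewrite mxE.
rewrite (partial_sum oU _ i Ux); last by move=> k; exact: smoothM.
rewrite -big_split; apply: eq_bigr => k _ /=; rewrite !mxE.
by rewrite partialM //; [exact: smooth_diff (sA a k) Ux | exact: smooth_diff (sB k b) Ux].
Qed.

Lemma mx_partialZ p q f (A : 'rV[R]_n -> 'M[R]_(p, q)) :
  smooth_on U f -> smooth_mx A ->
  mx_partial i (fun y => f y *: A y) x =
  partial i f x *: A x + f x *: mx_partial i A x.
Proof.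
move=> sf sA; apply/matrixP => a b; rewrite !mxE.
rewrite -partialM; [|exact: smooth_diff sf Ux|exact: smooth_diff (sA a b) Ux].
by congr (partial i _ x); apply/funext => y; rewrite mxE.
Qed.

Lemma mx_partial_tr p q (A : 'rV[R]_n -> 'M[R]_(p, q)) :
  mx_partial i (fun y => (A y)^T) x = (mx_partial i A x)^T.
Proof.
apply/matrixP => a b; rewrite !mxE.
by congr (partial i _ x); apply/funext => y; rewrite mxE.
Qed.

Lemma mx_partial_sum p q (I : Type) (r : seq I)
    (F : I -> 'rV[R]_n -> 'M[R]_(p, q)) :
  (forall k, smooth_mx (F k)) ->
  mx_partial i (fun y => \sum_(k <- r) F k y) x =
  \sum_(k <- r) mx_partial i (F k) x.
Proof.
move=> sF; apply/matrixP => a b; rewrite summxE !mxE.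
transitivity (partial i (fun y => \sum_(k <- r) F k y a b) x).
  by congr (partial i _ x); apply/funext => y; rewrite summxE.
rewrite (partial_sum oU _ i Ux); last by move=> k; exact: sF.
by apply: eq_bigr => k _; rewrite !mxE.
Qed.

Lemma mx_partialX p (A : 'rV[R]_n -> 'M[R]_p) N :
  smooth_mx A ->
  mx_partial i (fun y => A y ^+ N) x =
  \sum_(a < N) A x ^+ a *m mx_partial i A x *m A x ^+ (N.-1 - a).
Proof.
move=> sA; elim: N => [|N IH]; first by rewrite big_ord0 mx_partial_cst.
transitivity (mx_partial i (fun y => A y *m A y ^+ N) x).
  by apply: mx_partial_ext => y _; rewrite exprS.
rewrite mx_partialM ?IH //; last exact: smooth_mxX.
rewrite big_ord_recl /= subn0 expr0 mul1mx; congr (_ + _).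
rewrite mulmx_sumr; apply: eq_bigr => a _.
have -> : A x ^+ lift ord0 a = A x *m A x ^+ a by rewrite lift0 exprS.
rewrite !mulmxA; congr (_ *m _ ^+ _).
by rewrite /bump leq0n -subn1 -subnDA.
Qed.

End Rules.

Lemma mx_partialC p q (A : 'rV[R]_n -> 'M[R]_(p, q)) i j x :
  smooth_mx A -> U x ->
  mx_partial i (mx_partial j A) x = mx_partial j (mx_partial i A) x.
Proof.
have E k l : mx_partial k (mx_partial l A) x =
    \matrix_(a, b) partial k (partial l (fun y => A y a b)) x.
  apply/matrixP => a b; rewrite [LHS]mxE [RHS]mxE; congr (partial k _ x).
  by apply/funext => y; rewrite mxE.
move=> sA Ux; rewrite !E; apply/matrixP => a b; rewrite [LHS]mxE [RHS]mxE.
exact: partialC oU (sA a b) Ux.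
Qed.

End MatrixFields.

Lemma smooth_mx_comp (R : realType) n m (U : set 'rV[R]_n) (V : set 'rV[R]_m)
    p q (psi : 'rV[R]_n -> 'rV[R]_m) (A : 'rV[R]_m -> 'M[R]_(p, q)) :
  open U -> (forall x, U x -> V (psi x)) ->
  (forall k, smooth_on U (fun x => psi x 0 k)) -> smooth_mx V A ->
  smooth_mx U (fun x => A (psi x)).
Proof.
by move=> oU UV sp sA a b; exact: (smooth_comp oU UV sp (sA a b)).
Qed.

Lemma mx_partial_comp (R : realType) n m (U : set 'rV[R]_n) (V : set 'rV[R]_m)
    p q (psi : 'rV[R]_n -> 'rV[R]_m) (A : 'rV[R]_m -> 'M[R]_(p, q)) i x :
  (forall x, U x -> V (psi x)) ->
  (forall k, smooth_on U (fun x => psi x 0 k)) -> smooth_mx V A -> U x ->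
  mx_partial i (fun y => A (psi y)) x =
  \sum_(k < m) partial i (fun y => psi y 0 k) x *: mx_partial k A (psi x).
Proof.
move=> UV sp sA Ux; apply/matrixP => a b; rewrite summxE !mxE.
rewrite (@partial_comp R n m i psi (fun z => A z a b)).
- by apply: eq_bigr => k _; rewrite !mxE.
- by move=> k; exact: smooth_diff (sp k) Ux.
- exact: smooth_diff (sA a b) (UV _ Ux).
Qed.

Opaque mx_partial.

(** * Levi-Civita connection and curvature as matrices *)

Section Connection.
Variables (R : realType) (n : nat).

(** Row [j] of [conn G i x] is the covariant derivative of the [j]-th
    coordinate field along the [i]-th one. *)
Definition conn (G : 'rV[R]_n -> 'M[R]_n) (i : 'I_n) (x : 'rV[R]_n) : 'M[R]_n :=
  \matrix_(j, k) christoffel G k i j x.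

Definition lowered_conn (G : 'rV[R]_n -> 'M[R]_n) (i : 'I_n) (x : 'rV[R]_n)
  : 'M[R]_n :=
  2^-1 *: \matrix_(j, l) (mx_partial i G x j l + mx_partial j G x i l
                          - mx_partial l G x i j).

Lemma lowered_connE G i x j l : lowered_conn G i x j l =
  2^-1 * (mx_partial i G x j l + mx_partial j G x i l - mx_partial l G x i j).
Proof. by rewrite [LHS]mxE [X in _ * X]mxE. Qed.

Lemma connE G i x : conn G i x = lowered_conn G i x *m (invmx (G x))^T.
Proof.
apply/matrixP => j k; rewrite [LHS]mxE [LHS]/christoffel /lowered_conn -scalemxAl.
rewrite [RHS]mxE; congr (_ * _); rewrite mxE; apply: eq_bigr => l _.
by rewrite [X in _ = _ * X]mxE [RHS]mulrC; congr (_ * _); rewrite mxE !mx_partialE.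
Qed.

Section AtAPoint.
Variables (G : 'rV[R]_n -> 'M[R]_n) (x : 'rV[R]_n).
Hypotheses (Gsym : (G x)^T = G x) (Gunit : G x \in unitmx).

Lemma conn_mul i : conn G i x *m G x = lowered_conn G i x.
Proof. by rewrite connE trmx_inv Gsym mulmxKV. Qed.

(** The Koszul formula: the Levi-Civita connection is the only torsion-free
    connection that is compatible with the metric. *)
Lemma conn_unique (W : 'I_n -> 'M[R]_n) :
  (forall i j k, W i j k = W j i k) ->
  (forall i, W i *m G x + (W i *m G x)^T = mx_partial i G x) ->
  forall i, conn G i x = W i.
Proof.
move=> Wsym Wmetric i.
suff e : lowered_conn G i x = W i *m G x by rewrite connE e trmx_inv Gsym mulmxK.
pose X i := W i *m G x.
have Xsym a b c : X a b c = X b a c.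
  by rewrite !mxE; apply: eq_bigr => k _; rewrite Wsym.
apply/matrixP => j l; rewrite -/(X i) lowered_connE -!Wmetric.
have E a b c : (X a + (X a)^T) b c = X a b c + X a c b by rewrite !mxE.
rewrite !E (Xsym i l) (Xsym j l) (Xsym j i).
by move: (X i j l) (X l i j) (X l j i) => p q r; lra.
Qed.

Let T a b c := mx_partial a G x b c.

Let koszulC (S : 'I_n -> 'I_n -> 'I_n -> R) i j l :
  (forall a b c, S a b c = S a c b) ->
  2^-1 * (S i j l + S j i l - S l i j) = 2^-1 * (S j i l + S i j l - S l j i).
Proof. by move=> SE; rewrite (SE l i j) [S i j l + _]addrC. Qed.

Let koszulD (S : 'I_n -> 'I_n -> 'I_n -> R) i j l :
  (forall a b c, S a b c = S a c b) ->
  2^-1 * (S i j l + S j i l - S l i j) + 2^-1 * (S i l j + S l i j - S j i l)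
  = S i j l.
Proof. by move=> SE; rewrite (SE i l j); lra. Qed.

Hypothesis dGsym : forall i, (mx_partial i G x)^T = mx_partial i G x.

Lemma conn_sym i j k : conn G i x j k = conn G j x i k.
Proof.
rewrite !connE [LHS]mxE [RHS]mxE; apply: eq_bigr => l _; congr (_ * _).
rewrite !lowered_connE; apply: (koszulC (S := T)) => a b c.
by rewrite /T -[in LHS]dGsym mxE.
Qed.

Lemma conn_metric i :
  conn G i x *m G x + (conn G i x *m G x)^T = mx_partial i G x.
Proof.
rewrite conn_mul; apply/matrixP => j l.
rewrite [LHS]mxE [X in _ + X]mxE !lowered_connE.
apply: (koszulD (S := T)) => a b c.
by rewrite /T -[in LHS]dGsym mxE.
Qed.

End AtAPoint.

Definition curv (G : 'rV[R]_n -> 'M[R]_n) (i j : 'I_n) (x : 'rV[R]_n)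
  : 'M[R]_n :=
  mx_partial i (conn G j) x - mx_partial j (conn G i) x
  + conn G j x *m conn G i x - conn G i x *m conn G j x.

Lemma curvE G i j x k l : curv G i j x k l = riemann G l k i j x.
Proof.
have D a b : mx_partial a (conn G b) x k l = partial a (christoffel G l b k) x.
  by rewrite mx_partialE; congr (partial a _ x); apply/funext => y; rewrite mxE.
have M a b : (conn G a x *m conn G b x) k l =
    \sum_m christoffel G l b m x * christoffel G m a k x.
  by rewrite mxE; apply: eq_bigr => m _; rewrite mulrC; congr (_ * _); rewrite mxE.
have E (A B C F : 'M[R]_n) : (A - B + C - F) k l =
    A k l - B k l + (C k l - F k l) by rewrite !mxE addrA.
rewrite /curv E /riemann sumrB.
by congr (_ - _ + (_ - _)); [exact: D | exact: D | exact: M | exact: M].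
Qed.

Lemma ricciE G x : ricci G x = \matrix_(k, j) \sum_i curv G i j x k i.
Proof.
apply/matrixP => k j; rewrite [LHS]mxE [RHS]mxE; apply: eq_bigr => i _.
by rewrite curvE.
Qed.

End Connection.

(** * Invariance under changes of coordinates *)

Definition cov_diff (R : realType) n (G : 'rV[R]_n -> 'M[R]_n)
    (w : 'rV[R]_n -> 'rV[R]_n) (x : 'rV[R]_n) : 'M[R]_n :=
  \matrix_(i, j) (mx_partial i w x - w x *m (conn G i x)^T) 0 j.

Lemma codiffE (R : realType) n (G : 'rV[R]_n -> 'M[R]_n) w x :
  codiff G w x = - \tr (invmx (G x) *m (cov_diff G w x)^T).
Proof.
rewrite /codiff; congr (- _); apply: eq_bigr => i _.
rewrite [RHS]mxE; apply: eq_bigr => j _; congr (_ * _).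
have E (A B : 'rV[R]_n) : (A - B) 0 j = A 0 j - B 0 j by rewrite !mxE.
rewrite mxE [RHS]mxE E mx_partialE; congr (_ - _).
by rewrite [RHS]mxE; apply: eq_bigr => k _; rewrite mulrC mxE [in RHS]mxE.
Qed.

Section ChangeOfCoordinates.
Variables (R : realType) (n : nat) (U V : set 'rV[R]_n).
Variables (psi : 'rV[R]_n -> 'rV[R]_n) (J K G G' : 'rV[R]_n -> 'M[R]_n).
Hypotheses (oU : open U) (oV : open V).
Hypothesis UV : forall y, U y -> V (psi y).
Hypothesis spsi : forall k, smooth_on U (fun y => psi y 0 k).

Hypothesis JE : forall y i a, U y -> J y i a = partial i (fun z => psi z 0 a) y.
Hypothesis JK : forall y, U y -> J y *m K y = 1%:M.
Hypothesis sK : smooth_mx U K.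
Hypothesis sG' : smooth_mx V G'.
Hypothesis G'sym : forall z, V z -> (G' z)^T = G' z.
Hypothesis G'unit : forall z, V z -> G' z \in unitmx.
Hypothesis sconn' : forall i, smooth_mx V (conn G' i).
Hypothesis GE : forall y, U y -> G y = J y *m G' (psi y) *m (J y)^T.

Let KJ y : U y -> K y *m J y = 1%:M.
Proof. by move=> Uy; apply: mulmx1C; exact: JK. Qed.

Let sJ : smooth_mx U J.
Proof.
move=> i a; apply: (smooth_ext oU _ (smooth_partial i (spsi a))) => y Uy.
by rewrite JE.
Qed.

Let chain p q (A : 'rV[R]_n -> 'M[R]_(p, q)) i y : smooth_mx V A -> U y ->
  mx_partial i (fun y => A (psi y)) y =
  \sum_a J y i a *: mx_partial a A (psi y).
Proof.
move=> sA Uy; rewrite (mx_partial_comp i UV spsi sA Uy).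
by apply: eq_bigr => a _; rewrite JE.
Qed.

Let scomp p q (A : 'rV[R]_n -> 'M[R]_(p, q)) :
  smooth_mx V A -> smooth_mx U (fun y => A (psi y)).
Proof. exact: smooth_mx_comp. Qed.

Let dJ_sym i j a y : U y -> mx_partial i J y j a = mx_partial j J y i a.
Proof.
move=> Uy.
have E k l : mx_partial k J y l a = partial k (partial l (fun z => psi z 0 a)) y.
  by rewrite mx_partialE; apply: (partial_ext k oU _ Uy) => z Uz; rewrite JE.
by rewrite !E; exact: partialC oU (spsi a) Uy.
Qed.

Let theta i y : 'M[R]_n := \sum_a J y i a *: conn G' a (psi y).

Let stheta i : smooth_mx U (theta i).
Proof.
apply: smooth_mx_sum => // a; apply: (smooth_mxZ oU (sJ i a)).
exact: (scomp (sconn' a)).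
Qed.

Let dG'sym a z : V z -> (mx_partial a G' z)^T = mx_partial a G' z.
Proof.
move=> Vz; rewrite -mx_partial_tr.
by apply: (mx_partial_ext oV a Vz) => t Vt; rewrite G'sym.
Qed.

Let Gsym y : U y -> (G y)^T = G y.
Proof. by move=> Uy; rewrite GE // !trmx_mul trmxK G'sym ?mulmxA //; exact: UV. Qed.

Let Junit y : U y -> J y \in unitmx.
Proof. by move=> Uy; case/mulmx1_unit: (JK Uy). Qed.

Let Gunit y : U y -> G y \in unitmx.
Proof.
move=> Uy; rewrite GE // !unitmx_mul unitmx_tr !Junit //= G'unit //; exact: UV.
Qed.

Let W i y := (J y *m theta i y + mx_partial i J y) *m K y.

Let WG i y : U y ->
  W i y *m G y = (J y *m theta i y + mx_partial i J y) *m G' (psi y) *m (J y)^T.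
Proof.
by move=> Uy; rewrite GE // /W !mulmxA -[_ *m K y *m J y]mulmxA KJ // mulmx1.
Qed.

(** The transformed Christoffel matrices are again torsion-free, because
    second derivatives of the coordinates commute, and compatible with the
    transformed metric. *)
Lemma conn_change i y : U y -> conn G i y = W i y.
Proof.
move=> Uy; apply: (conn_unique (Gsym Uy) (Gunit Uy) (W := W ^~ y)) => {i}.
- move=> i j k; rewrite /W [LHS]mxE [RHS]mxE; apply: eq_bigr => b _.
  congr (_ * _); rewrite [LHS]mxE [RHS]mxE (dJ_sym i j b Uy); congr (_ + _).
  have T p q : (J y *m theta p y) q b =
      \sum_a \sum_c J y p a * J y q c * conn G' a (psi y) c b.
    rewrite mxE exchange_big; apply: eq_bigr => c _ /=.
    rewrite /theta summxE mulr_sumr; apply: eq_bigr => a _.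
    by rewrite [X in _ * X]mxE mulrCA mulrA.
  rewrite !T exchange_big; apply: eq_bigr => c _; apply: eq_bigr => a _ /=.
  rewrite [J y i _ * _]mulrC; congr (_ * _).
  apply: conn_sym => d; exact: dG'sym (UV Uy).
- move=> i; rewrite WG //.
  rewrite (mx_partial_ext oU i Uy GE).
  have s1 := smooth_mxM oU sJ (scomp sG').
  rewrite (mx_partialM oU i Uy s1 (smooth_mx_tr oU sJ)).
  rewrite (mx_partialM oU i Uy sJ (scomp sG')) mx_partial_tr chain //.
  have -> : \sum_a J y i a *: mx_partial a G' (psi y) =
      theta i y *m G' (psi y) + (theta i y *m G' (psi y))^T.
    rewrite /theta mulmx_suml raddf_sum -big_split; apply: eq_bigr => a _ /=.
    rewrite -scalemxAl linearZ -scalerDr /=; congr (_ *: _).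
    by rewrite (conn_metric (G'sym (UV Uy)) (G'unit (UV Uy))) // => d; exact: dG'sym (UV Uy).
  rewrite !trmx_mul !trmxK linearD /= !trmx_mul G'sym; last exact: UV.
  rewrite !mulmxDl !mulmxDr !mulmxDl !mulmxA.
  by rewrite [X in X + _ = _]addrC !addrA.
Qed.


Let sconn i : smooth_mx U (conn G i).
Proof.
apply: (smooth_mx_ext oU (A := W i)) => [y Uy|]; first by rewrite conn_change.
apply: smooth_mxM => //; apply: smooth_mxD => //; last exact: smooth_mx_partial.
exact: smooth_mxM.
Qed.

Let connJ i y : U y ->
  conn G i y *m J y = J y *m theta i y + mx_partial i J y.
Proof. by move=> Uy; rewrite conn_change // /W -mulmxA KJ // mulmx1. Qed.

Let dtheta i j y : U y -> mx_partial i (theta j) y =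
  \sum_a (mx_partial i J y j a *: conn G' a (psi y)
          + \sum_b (J y i b * J y j a) *: mx_partial b (conn G' a) (psi y)).
Proof.
move=> Uy; rewrite (mx_partial_sum oU i Uy); last first.
  by move=> a; apply: (smooth_mxZ oU (sJ j a)); exact: (scomp (sconn' a)).
apply: eq_bigr => a _.
rewrite (mx_partialZ i Uy (sJ j a) (scomp (sconn' a))) -mx_partialE chain //.
congr (_ + _); rewrite scaler_sumr; apply: eq_bigr => b _.
by rewrite scalerA mulrC.
Qed.

(** Differentiating [connJ] instead of [conn_change] keeps the derivative of
    the inverse Jacobian out of the computation. *)
Let dconnJ i j y : U y ->
  (mx_partial i (conn G j) y + conn G j y *m conn G i y) *m J y =
  mx_partial i J y *m theta j y + mx_partial j J y *m theta i y
  + mx_partial i (mx_partial j J) y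
  + J y *m (mx_partial i (theta j) y + theta j y *m theta i y).
Proof.
move=> Uy.
have := mx_partial_ext oU i Uy (connJ j).
rewrite (mx_partialM oU i Uy (sconn j) sJ).
have sp := smooth_mx_partial oU j sJ.
have st := stheta j.
rewrite (mx_partialD i Uy (smooth_mxM oU sJ st) sp).
rewrite (mx_partialM oU i Uy sJ st) => /(canRL (addrK _)) E.
rewrite mulmxDl E -[conn G j y *m _ *m _]mulmxA connJ // mulmxDr mulmxA connJ //.
rewrite !mulmxDl !mulmxDr !mulmxA.
move: (mx_partial i J y *m _) (mx_partial j J y *m _) (conn G j y *m _).
move: (J y *m mx_partial _ _ _) (mx_partial _ (mx_partial _ _) _) (J y *m _ *m _).
move=> a b c d e f.
by apply/matrixP => k l; rewrite !mxE; ring.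
Qed.

Lemma curv_change i j y : U y ->
  curv G i j y *m J y =
  J y *m \sum_a \sum_b (J y i a * J y j b) *: curv G' a b (psi y).
Proof.
move=> Uy.
have -> : curv G i j y = mx_partial i (conn G j) y + conn G j y *m conn G i y
    - (mx_partial j (conn G i) y + conn G i y *m conn G j y).
  rewrite /curv; move: (mx_partial i _ y) (mx_partial j _ y) (_ *m _) (_ *m _).
  by move=> a b c d; apply/matrixP => k l; rewrite !mxE; ring.
rewrite mulmxBl !dconnJ // (mx_partialC oU i j sJ Uy).
rewrite [mx_partial j J y *m _ + _]addrC opprD addrACA subrr add0r -mulmxBr.
congr (_ *m _).
have tt p q : theta p y *m theta q y = \sum_a \sum_b (J y q a * J y p b) *:
    (conn G' b (psi y) *m conn G' a (psi y)).
  rewrite /theta mulmx_suml exchange_big; apply: eq_bigr => b _ /=.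
  rewrite mulmx_sumr; apply: eq_bigr => a _.
  by rewrite -scalemxAl -scalemxAr scalerA mulrC.
rewrite !tt !dtheta // !big_split /=.
have -> : \sum_a mx_partial j J y i a *: conn G' a (psi y) =
          \sum_a mx_partial i J y j a *: conn G' a (psi y).
  by apply: eq_bigr => a _; rewrite (dJ_sym j i a Uy).
have D (X A B A1 B1 : 'M[R]_n) :
    X + A + B - (X + A1 + B1) = A - A1 + (B - B1).
  by apply/matrixP => k l; rewrite !mxE; ring.
rewrite D {D} [X in X - _ + _]exchange_big /= [X in _ + (_ - X)]exchange_big /=.
rewrite -!sumrB -big_split; apply: eq_bigr => a _ /=.
rewrite -!sumrB -big_split; apply: eq_bigr => b _ /=.
rewrite ![J y j b * _]mulrC -!scalerBr -scalerDr; congr (_ *: _).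
by rewrite /curv addrA.
Qed.

Lemma ricci_change y : U y ->
  ricci G y = J y *m ricci G' (psi y) *m (J y)^T.
Proof.
move=> Uy; rewrite !ricciE.
have C i j : curv G i j y = J y *m (\sum_a \sum_b
    (J y i a * J y j b) *: curv G' a b (psi y)) *m K y.
  by rewrite -curv_change // -mulmxA JK // mulmx1.
apply/matrixP => k j; rewrite [LHS]mxE.
transitivity (\sum_i \sum_a \sum_b J y i a * J y j b *
    (J y *m curv G' a b (psi y) *m K y) k i).
  apply: eq_bigr => i _; rewrite C mulmx_sumr mulmx_suml summxE.
  apply: eq_bigr => a _; rewrite mulmx_sumr mulmx_suml summxE.
  by apply: eq_bigr => b _; rewrite -scalemxAr -scalemxAl [LHS]mxE.
rewrite exchange_big /=.
under eq_bigr => a _ do rewrite exchange_big /=.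
rewrite exchange_big [RHS]mxE; apply: eq_bigr => b _ /=.
rewrite [X in _ = _ * X]mxE [X in _ = X * _]mxE mulr_suml.
under [RHS]eq_bigr => d _ do rewrite [X in _ * X * _]mxE mulr_sumr mulr_suml.
rewrite [RHS]exchange_big; apply: eq_bigr => a _ /=.
transitivity (J y j b * (J y *m curv G' a b (psi y) *m K y *m J y) k a).
  rewrite [X in _ = _ * X]mxE mulr_sumr; apply: eq_bigr => i _.
  by rewrite [X in _ = _ * X]mulrC [RHS]mulrA; congr (_ * _); rewrite mulrC.
rewrite -(mulmxA _ (K y)) KJ // mulmx1 mxE mulr_sumr.
by apply: eq_bigr => d _; rewrite mulrC.
Qed.


Let JtKt y : U y -> (J y)^T *m (K y)^T = 1%:M.
Proof. by move=> Uy; rewrite -trmx_mul KJ // trmx1. Qed.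

Lemma invmx_change y : U y ->
  invmx (G y) = (K y)^T *m invmx (G' (psi y)) *m K y.
Proof.
move=> Uy; have XG : (K y)^T *m invmx (G' (psi y)) *m K y *m G y = 1%:M.
  rewrite GE // !mulmxA -[_ *m K y *m J y]mulmxA KJ // mulmx1.
  rewrite mulmxKV; first by rewrite -trmx_mul JK // trmx1.
  by apply: G'unit; exact: UV.
by rewrite -[LHS]mul1mx -XG mulmxK // Gunit.
Qed.

Lemma schouten_change y : U y ->
  schouten G y = J y *m schouten G' (psi y) *m (J y)^T.
Proof.
move=> Uy; rewrite /schouten /schouten_trace.
have -> : scalar_curvature G y = scalar_curvature G' (psi y).
  rewrite /scalar_curvature ricci_change // invmx_change // -!mulmxA.
  rewrite [K y *m (J y *m _)]mulmxA KJ // mul1mx.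
  by rewrite [LHS]mxtrace_mulC -!mulmxA JtKt // mulmx1.
rewrite ricci_change // GE // -scalemxAr -scalemxAl mulmxBr mulmxBl.
by rewrite -scalemxAr -scalemxAl.
Qed.

Lemma schouten_pow_change N y : U y ->
  schouten_pow G N y = J y *m schouten_pow G' N (psi y) *m (J y)^T.
Proof.
move=> Uy; rewrite /schouten_pow invmx_change // schouten_change // GE //.
set E := invmx (G' (psi y)) *m schouten G' (psi y).
have -> : (K y)^T *m invmx (G' (psi y)) *m K y *m
    (J y *m schouten G' (psi y) *m (J y)^T) = (K y)^T *m E *m (J y)^T.
  by rewrite /E !mulmxA -[_ *m K y *m J y]mulmxA KJ // mulmx1.
rewrite -!mulmxA; congr (_ *m (_ *m _)); rewrite !mulmxA.
elim: N => [|N IH]; first by rewrite !expr0 mulmx1 mul1mx.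
rewrite !exprSr -!mulmxE mulmxA IH -!mulmxA; congr (_ *m _).
by rewrite [(J y)^T *m ((K y)^T *m _)]mulmxA JtKt // mul1mx.
Qed.

(** Each ingredient of [local_T_op] transforms as a tensor, so that the Jacobian
    and its inverse [K] cancel in the final trace. *)
Lemma local_T_op_change N u u' y :
  smooth_on V u' -> smooth_mx V (ext_diff u') ->
  smooth_mx V (fun z => hash (G' z) (schouten_pow G' N z) (ext_diff u' z)) ->
  (forall z, U z -> u z = u' (psi z)) -> U y ->
  local_T_op N G u y = local_T_op N G' u' (psi y).
Proof.
move=> su' sdu' sw' uE Uy.
set w' := (fun z => hash _ _ _) in sw'.
have du z : U z -> ext_diff u z = ext_diff u' (psi z) *m (J z)^T.
  move=> Uz; apply/rowP => i; rewrite [LHS]mxE [RHS]mxE.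
  rewrite (partial_ext i oU uE Uz) (@partial_comp R n n i psi u').
  - by apply: eq_bigr => a _; rewrite [X in _ = X * _]mxE [X in _ = _ * X]mxE JE // mulrC.
  - by move=> k; exact: smooth_diff (spsi k) Uz.
  - exact: smooth_diff su' (UV Uz).
rewrite /local_T_op -/w'; set w := (fun z => hash (G z) _ _).
have wE z : U z -> w z = w' (psi z) *m (J z)^T.
  move=> Uz; rewrite /w /w' /hash /sharp du // invmx_change //.
  rewrite schouten_pow_change // !mulmxA.
  rewrite -(mulmxA _ (J z)^T) JtKt // mulmx1 -(mulmxA _ (K z)) KJ //.
  by rewrite mulmx1.
rewrite [LHS]codiffE [RHS]codiffE.
apply: (congr1 -%R).

have -> : cov_diff G w y = J y *m cov_diff G' w' (psi y) *m (J y)^T.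
  have dw i : mx_partial i w y - w y *m (conn G i y)^T = \sum_a J y i a *:
      ((mx_partial a w' (psi y) - w' (psi y) *m (conn G' a (psi y))^T) *m (J y)^T).
    have st := smooth_mx_tr oU sJ.
    rewrite (mx_partial_ext oU i Uy wE) (mx_partialM oU i Uy (scomp sw') st).
    rewrite chain // mx_partial_tr wE // conn_change // /W.
    rewrite trmx_mul !mulmxA -(mulmxA _ (J y)^T) JtKt // mulmx1.
    rewrite [(_ + _)^T]linearD /= mulmxDr opprD addrACA subrr addr0.
    rewrite trmx_mul mulmxA -mulmxBl /theta raddf_sum mulmx_sumr.
    rewrite -sumrB mulmx_suml; apply: eq_bigr => a _ /=.
    by rewrite linearZ /= -scalemxAr -scalerBr -scalemxAl.
  apply/matrixP => i j; rewrite [LHS]mxE dw summxE.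
  rewrite -mulmxA [RHS]mxE. apply: eq_bigr => a _.
  rewrite [LHS]mxE; congr (_ * _); rewrite [LHS]mxE [RHS]mxE.
  by apply: eq_bigr => b _; congr (_ * _); rewrite [RHS]mxE.
rewrite !trmx_mul trmxK invmx_change // -!mulmxA.
rewrite [K y *m (J y *m _)]mulmxA KJ // mul1mx.
by rewrite [LHS]mxtrace_mulC -!mulmxA JtKt // mulmx1.
Qed.

End ChangeOfCoordinates.

(** * Conformally flat metrics *)

Section Kronecker.
Variables (R : realType) (n : nat) (p : 'I_n -> R) (H : 'I_n -> 'I_n -> R).

(** The Christoffel symbol of a conformally flat metric whose logarithmic
    factor has first derivatives [p], and its derivative along the [l]-th
    coordinate in terms of the second derivatives [H]. *)
Definition gam (k i j : 'I_n) : R :=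
  (k == i)%:R * p j + (k == j)%:R * p i - (i == j)%:R * p k.

Definition dgam (l k i j : 'I_n) : R :=
  (k == i)%:R * H l j + (k == j)%:R * H l i - (i == j)%:R * H l k.

Lemma gamC k i j : gam k i j = gam k j i.
Proof. by rewrite /gam (eq_sym i j); ring. Qed.

Lemma gam_compat i j k : gam k i j + gam j i k = 2 * (k == j)%:R * p i.
Proof. by rewrite /gam (eq_sym i j) (eq_sym k j) (eq_sym i k); ring. Qed.

Lemma sum_delta (a : 'I_n) (f : 'I_n -> R) : \sum_m (m == a)%:R * f m = f a.
Proof.
rewrite (bigD1 a) //= eqxx mul1r big1 ?addr0 // => m /negbTE ->.
by rewrite mul0r.
Qed.

Let q : R := \sum_m p m * p m.

Let gam_contr (F : 'I_n -> R) a b : \sum_m gam a b m * F m =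
  (a == b)%:R * (\sum_m p m * F m) + p b * F a - p a * F b.
Proof.
rewrite -(sum_delta a (fun m => p b * F m)) -(sum_delta b (fun m => p a * F m)).
rewrite mulr_sumr -big_split -sumrB; apply: eq_bigr => m _ /=.
by rewrite /gam (eq_sym a m) (eq_sym b m); ring.
Qed.

Let p_gam a b : \sum_m p m * gam m a b = 2 * p a * p b - (a == b)%:R * q.
Proof.
rewrite /q mulr_sumr.
transitivity (\sum_m (m == a)%:R * (p m * p b)
    + \sum_m (m == b)%:R * (p m * p a) - \sum_m (a == b)%:R * (p m * p m)).
  by rewrite -big_split -sumrB; apply: eq_bigr => m _ /=; rewrite /gam; ring.
by rewrite !sum_delta; congr (_ - _); ring.
Qed.

Let gam_diag a b : gam a a b = p b.
Proof. by rewrite /gam eqxx mul1r addrK. Qed.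

Lemma gam_ricci k j : H j k = H k j ->
  \sum_i (dgam i i j k - dgam j i i k
          + \sum_m (gam i i m * gam m j k - gam i j m * gam m i k)) =
  (n%:R - 2) * (p k * p j - H k j)
  - (k == j)%:R * (\sum_i H i i + (n%:R - 2) * q).
Proof.
move=> HC.
transitivity (\sum_i ((i == j)%:R * H i k + (i == k)%:R * H i j
    - (j == k)%:R * H i i - H j k
    + (2 * p j * p k - (j == k)%:R * q)
    - ((i == j)%:R * (2 * p i * p k - (i == k)%:R * q - p i * p k)
       + p j * p k - (j == k)%:R * (p i * p i)
       + (i == k)%:R * (p i * p j)))).
  apply: eq_bigr => i _; rewrite sumrB.
  have -> : \sum_m gam i i m * gam m j k = 2 * p j * p k - (j == k)%:R * q.
    by rewrite -p_gam; apply: eq_bigr => m _; rewrite gam_diag.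
  rewrite gam_contr p_gam gam_diag /gam /dgam eqxx (eq_sym j i) mul1r; ring.
rewrite !(sumrB, big_split) /= !sum_delta -!mulr_sumr.
have sc (c : R) : \sum_(i < n) c = n%:R * c.
  by rewrite sumr_const card_ord mulr_natl.
rewrite !sc -/q HC (eq_sym k j); ring.
Qed.

End Kronecker.

Section Dot.
Variables (R : realType) (n : nat).

Definition dotr (a b : 'rV[R]_n) : R := \sum_i a 0 i * b 0 i.

Lemma mxtrace_outer (a : 'rV[R]_n) : \tr (a^T *m a) = dotr a a.
Proof. by apply: eq_bigr => i _; rewrite mxE big_ord1 mxE. Qed.

Lemma ricci_entries (p : 'I_n -> R) (H : 'I_n -> 'I_n -> R) (d : 'rV[R]_n)
    (h : 'M[R]_n) a k j :
  (forall i, d 0 i = p i) -> (forall i l, h i l = H i l) ->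
  a * (p k * p j - H k j)
  - (k == j)%:R * (\sum_i H i i + a * \sum_i p i * p i) =
  (a *: (d^T *m d - h) - (\tr h + a * dotr d d) *: 1%:M) k j.
Proof.
move=> dp hH; have -> : \sum_i H i i = \tr h by apply: eq_bigr => i _; rewrite hH.
have -> : \sum_i p i * p i = dotr d d by apply: eq_bigr => i _; rewrite dp.
by rewrite !mxE big_ord1 !mxE hH !dp [X in _ = _ - X]mulrC.
Qed.

End Dot.

Section FlatChart.
Variables (R : realType) (n : nat) (V : set 'rV[R]_n) (s : 'rV[R]_n -> R).
Hypotheses (oV : open V) (ss : smooth_on V s).

Definition flat_metric (y : 'rV[R]_n) : 'M[R]_n := expR (2 * s y) *: 1%:M.

Definition hess (f : 'rV[R]_n -> R) (x : 'rV[R]_n) : 'M[R]_n :=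
  \matrix_(i, j) partial i (partial j f) x.

Lemma hessE f x i j : hess f x i j = partial i (partial j f) x.
Proof. exact: mxE. Qed.

Definition flat_schouten (x : 'rV[R]_n) : 'M[R]_n :=
  (ext_diff s x)^T *m ext_diff s x - hess s x
  - (2^-1 * dotr (ext_diff s x) (ext_diff s x))%:M.

Let p (x : 'rV[R]_n) (i : 'I_n) : R := partial i s x.
Let H (x : 'rV[R]_n) (i j : 'I_n) : R := partial i (partial j s) x.

Lemma smooth_ext_diff f : smooth_on V f -> smooth_mx V (ext_diff f).
Proof.
move=> sf i j; apply: (smooth_ext oV _ (smooth_partial j sf)) => x _.
by rewrite mxE.
Qed.

Lemma smooth_flat_metric : smooth_mx V flat_metric.
Proof.
apply: smooth_mxZ => //; last exact: smooth_mx_cst.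
by apply/smooth_exp/smoothM => //; exact: smooth_cst.
Qed.

Lemma flat_metric_sym x : (flat_metric x)^T = flat_metric x.
Proof. by rewrite /flat_metric linearZ /= trmx1. Qed.

Lemma flat_metric_unit x : flat_metric x \in unitmx.
Proof.
by rewrite /flat_metric scalemx1 unitmxE det_scalar unitfE expf_neq0 // gt_eqF ?expR_gt0.
Qed.

Lemma invmx_flat_metric x : invmx (flat_metric x) = expR (- (2 * s x)) *: 1%:M.
Proof. by rewrite /flat_metric scalemx1 invmx_scalar expRN scalemx1. Qed.

Lemma flat_conn i x : V x ->
  conn flat_metric i x = \matrix_(j, k) gam (fun a => partial a s x) k i j.
Proof.
move=> Vx.
apply: (conn_unique (W := fun i => \matrix_(j, k) gam (p x) k i j)
  (flat_metric_sym x) (flat_metric_unit x)) => {i} [i j k|i].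
  by rewrite mxE [RHS]mxE gamC.
have s2 : smooth_on V (fun y => 2 * s y) by apply: smoothM => //; exact: smooth_cst.
rewrite (mx_partialZ i Vx (smooth_exp oV s2) (smooth_mx_cst oV _)).
rewrite mx_partial_cst // scaler0 addr0.
rewrite partial_exp ?partialM ?partial_cst; last 3 first.
- exact: smooth_diff (smooth_cst oV _) Vx.
- exact: smooth_diff ss Vx.
- exact: smooth_diff s2 Vx.
rewrite mul0r add0r /flat_metric -scalemxAr mulmx1 linearZ -scalerDr -scalerA /=.
congr (_ *: _); apply/matrixP => j k.
rewrite [LHS]mxE [X in X + _]mxE [X in _ + X]mxE [X in _ + X]mxE [RHS]mxE.
by rewrite gam_compat [X in _ = _ * X]mxE (eq_sym k j) mulrAC.
Qed.

Lemma smooth_flat_conn i : smooth_mx V (conn flat_metric i).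
Proof.
move=> j k; apply: (smooth_ext oV (f := fun x => gam (p x) k i j)) => [x Vx|].
  by rewrite flat_conn // mxE.
have sp a : smooth_on V (p ^~ a) by exact: smooth_partial.
by rewrite /gam; apply: smoothB => //; [apply: smoothD => // |];
  apply: smoothM => //; exact: smooth_cst.
Qed.

Let dgamE l a b c x : V x ->
  partial l (fun y => gam (p y) a b c) x = dgam (H x) l a b c.
Proof.
move=> Vx.
have sp d : smooth_on V (p ^~ d) by exact: smooth_partial.
have dl (r : R) d : partial l (fun y => r * p y d) x = r * H x l d.
  rewrite partialM ?partial_cst ?mul0r ?add0r //.
  exact: smooth_diff (sp d) Vx.
have sl (r : R) d : smooth_on V (fun y => r * p y d).
  by apply: smoothM => //; exact: smooth_cst.
have sl2 (r r' : R) d d' : smooth_on V (fun y => r * p y d + r' * p y d').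
  by apply: smoothD.
rewrite /gam partialD; last 2 first.
- exact: smooth_diff (sl2 _ _ _ _) Vx.
- exact: smooth_diff (smoothN oV (sl _ _)) Vx.
rewrite partialN; last exact: smooth_diff (sl _ _) Vx.
rewrite partialD; [|exact: smooth_diff (sl _ _) Vx..].
by congr (_ + _ - _); exact: dl.
Qed.

Lemma flat_ricci x : V x -> ricci flat_metric x =
  (n%:R - 2) *: ((ext_diff s x)^T *m ext_diff s x - hess s x)
  - (\tr (hess s x)
     + (n%:R - 2) * dotr (ext_diff s x) (ext_diff s x)) *: 1%:M.
Proof.
move=> Vx; apply/matrixP => k j.
have cE a b c y : V y -> christoffel flat_metric a b c y = gam (p y) a b c.
  move=> Vy; transitivity (conn flat_metric b y c a); first by rewrite mxE.
  by rewrite flat_conn // mxE.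
have HC : H x j k = H x k j by exact: partialC oV ss Vx.
transitivity ((n%:R - 2) * (p x k * p x j - H x k j)
  - (k == j)%:R * (\sum_i H x i i + (n%:R - 2) * \sum_i p x i * p x i)).
  rewrite [LHS]mxE -(gam_ricci (p x) HC); apply: eq_bigr => i _.
  rewrite /riemann.
  rewrite (partial_ext i oV (fun y => cE i j k y) Vx).
  rewrite (partial_ext j oV (fun y => cE i i k y) Vx) !(dgamE _ _ _ _ Vx).
  apply: congr1; apply: eq_bigr => m _.
  by rewrite (cE i i m x Vx) (cE m j k x Vx) (cE i j m x Vx) (cE m i k x Vx).
by apply: ricci_entries => [i|i l]; exact: mxE.
Qed.

Hypothesis n3 : (2 < n)%N.

Lemma flat_schoutenE x : V x -> schouten flat_metric x = flat_schouten x.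
Proof.
move=> Vx; rewrite /schouten /schouten_trace /scalar_curvature.
rewrite invmx_flat_metric -scalemxAl mul1mx mxtraceZ flat_ricci //.
have trE (a b : R) (A B : 'M[R]_n) :
    \tr (a *: (A - B) - b *: 1%:M) = a * (\tr A - \tr B) - b * n%:R.
  by rewrite raddfB /= !mxtraceZ raddfB /= mxtrace1.
rewrite trE mxtrace_outer.
rewrite /flat_schouten /flat_metric scalerA.
set e := expR (- _); set e' := expR _.
have ee : e * e' = 1 by rewrite /e /e' expRN mulVf // gt_eqF // expR_gt0.
have n2 : n%:R - 2 != 0 :> R.
  by rewrite subr_eq0 eqr_nat gtn_eqF.
have n1 : n%:R - 1 != 0 :> R.
  by rewrite subr_eq0 -[1]/(1%:R) eqr_nat gtn_eqF // ltnW.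
set h := \tr _; set d := dotr _ _; set A := _ - hess s x.
have gen (c a b g m : R) : c * a = 1 -> c * (b + g) = m ->
    c *: (a *: A - b *: 1%:M - g *: 1%:M) = A - m%:M.
  move=> ca cbg; rewrite -addrA -opprD -scalerDl scalerBr !scalerA ca cbg.
  by rewrite scale1r scalemx1.
apply: gen; first exact: mulVf.
rewrite -[_ / _ * e']mulrAC -[_ * _ * e']mulrAC ee mul1r; field.
by rewrite n2 n1.
Qed.

End FlatChart.

(** * Divergence, Lie derivatives and double commutators *)

Section VectorFields.
Variables (R : realType) (n : nat) (V : set 'rV[R]_n) (s : 'rV[R]_n -> R).
Hypotheses (oV : open V) (ss : smooth_on V s).
Implicit Types (f u v phi : 'rV[R]_n -> R) (W Y : 'rV[R]_n -> 'rV[R]_n).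
Implicit Types (a b : 'rV[R]_n -> 'M[R]_n).

Definition jac W (x : 'rV[R]_n) : 'M[R]_n := \matrix_(k, j) mx_partial k W x 0 j.

(** The divergence of a vector field with respect to the volume form
    [expR (n * s)] times Lebesgue measure. *)
Definition wdiv W (x : 'rV[R]_n) : R :=
  \tr (jac W x) + n%:R * dotr (ext_diff s x) (W x).

Definition along W f (x : 'rV[R]_n) : R := dotr (W x) (ext_diff f x).

Definition bracket W Y (x : 'rV[R]_n) : 'rV[R]_n :=
  W x *m jac Y x - Y x *m jac W x.

(** The Lie derivative of a contravariant symmetric 2-tensor. *)
Definition lie W a (x : 'rV[R]_n) : 'M[R]_n :=
  \sum_k W x 0 k *: mx_partial k a x - (a x *m jac W x + (jac W x)^T *m a x).

(** The operator [u |-> delta (a # du)] for the volume form of [wdiv], the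
    tensor [a] having its indices raised. *)
Definition wlap a u (x : 'rV[R]_n) : R := - wdiv (fun y => ext_diff u y *m a y) x.

Lemma dotrE (c d : 'rV[R]_n) : dotr c d = (c *m d^T) 0 0.
Proof. by rewrite mxE; apply: eq_bigr => i _; rewrite [in RHS]mxE. Qed.

Lemma dotrC (c d : 'rV[R]_n) : dotr c d = dotr d c.
Proof. by apply: eq_bigr => i _; rewrite mulrC. Qed.

Lemma dotrDr (c d d' : 'rV[R]_n) : dotr c (d + d') = dotr c d + dotr c d'.
Proof. by rewrite !dotrE linearD /= mulmxDr mxE. Qed.

Lemma dotrZr r (c d : 'rV[R]_n) : dotr c (r *: d) = r * dotr c d.
Proof. by rewrite !dotrE linearZ /= -scalemxAr mxE. Qed.

Lemma dotr_mulr (c d : 'rV[R]_n) (A : 'M[R]_n) :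
  dotr c (d *m A) = dotr (c *m A^T) d.
Proof. by rewrite !dotrE trmx_mul mulmxA. Qed.

Lemma jacE W x k j : jac W x k j = mx_partial k W x 0 j.
Proof. exact: mxE. Qed.

Lemma smooth_jac W : smooth_mx V W -> smooth_mx V (jac W).
Proof.
move=> sW k j; apply: (smooth_ext oV _ (smooth_mx_partial oV k sW 0 j)) => x _.
by rewrite jacE.
Qed.

Lemma smooth_dotr W Y : smooth_mx V W -> smooth_mx V Y ->
  smooth_on V (fun x => dotr (W x) (Y x)).
Proof. by move=> sW sY; apply: smooth_sum => // i; exact: smoothM. Qed.

Lemma smooth_along W f : smooth_mx V W -> smooth_on V f -> smooth_on V (along W f).
Proof. by move=> sW sf; apply: smooth_dotr => //; exact: smooth_ext_diff. Qed.

Lemma smooth_wdiv W : smooth_mx V W -> smooth_on V (wdiv W).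
Proof.
move=> sW; apply: smoothD => //.
  by apply: smooth_sum => // i; exact: (smooth_jac sW).
apply: smoothM => //; first exact: smooth_cst.
by apply: smooth_dotr => //; exact: smooth_ext_diff.
Qed.

Lemma smooth_wlap a u : smooth_mx V a -> smooth_on V u -> smooth_on V (wlap a u).
Proof.
move=> sa su; apply: smoothN => //; apply: smooth_wdiv.
by apply: smooth_mxM => //; exact: smooth_ext_diff.
Qed.

Lemma smooth_lie W a : smooth_mx V W -> smooth_mx V a -> smooth_mx V (lie W a).
Proof.
move=> sW sa; rewrite /lie; apply: smooth_mxD => //.
  apply: smooth_mx_sum => // k.
  exact: (smooth_mxZ oV (sW 0 k) (smooth_mx_partial oV k sa)).
apply: smooth_mxN => //; have sj := smooth_jac sW.
by apply: smooth_mxD => //; apply: smooth_mxM => //; exact: smooth_mx_tr.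
Qed.

Lemma jac_ext W Y x : V x -> (forall y, V y -> W y = Y y) -> jac W x = jac Y x.
Proof.
move=> Vx WY; apply/matrixP => k j.
by rewrite !jacE (mx_partial_ext oV k Vx WY).
Qed.

Lemma wdiv_ext W Y x : V x -> (forall y, V y -> W y = Y y) -> wdiv W x = wdiv Y x.
Proof. by move=> Vx WY; rewrite /wdiv (jac_ext Vx WY) WY. Qed.

Lemma wdivD W Y x : smooth_mx V W -> smooth_mx V Y -> V x ->
  wdiv (fun y => W y + Y y) x = wdiv W x + wdiv Y x.
Proof.
move=> sW sY Vx; rewrite /wdiv dotrDr mulrDr addrACA; congr (_ + _).
rewrite -mxtraceD; congr (\tr _); apply/matrixP => k j.
by rewrite [RHS]mxE !jacE (mx_partialD k Vx sW sY) [LHS]mxE.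
Qed.

Lemma wdivZ f W x : smooth_on V f -> smooth_mx V W -> V x ->
  wdiv (fun y => f y *: W y) x = f x * wdiv W x + along W f x.
Proof.
move=> sf sW Vx; rewrite /wdiv dotrZr mulrDr [RHS]addrAC.
congr (_ + _); last by rewrite mulrCA.
rewrite -mxtraceZ /along /dotr -big_split; apply: eq_bigr => i _ /=.
rewrite jacE (mx_partialZ i Vx sf sW) [LHS]mxE [X in X + _]mxE [X in _ + X]mxE.
by rewrite [X in _ = X + _]mxE jacE [ext_diff _ _ _ _]mxE addrC [W x 0 i * _]mulrC.
Qed.

Lemma wdiv0 x : wdiv (fun=> 0) x = 0.
Proof.
rewrite /wdiv dotrE trmx0 mulmx0 mxE mulr0 addr0; apply: big1 => i _.
by rewrite jacE mx_partial_cst mxE.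
Qed.

Lemma ext_diffD f u x : smooth_on V f -> smooth_on V u -> V x ->
  ext_diff (fun y => f y + u y) x = ext_diff f x + ext_diff u x.
Proof.
move=> sf su Vx; apply/rowP => i; rewrite [LHS]mxE [RHS]mxE.
rewrite [X in _ = X + _]mxE [X in _ = _ + X]mxE partialD //.
  exact: smooth_diff sf Vx.
exact: smooth_diff su Vx.
Qed.

Lemma ext_diffM f u x : smooth_on V f -> smooth_on V u -> V x ->
  ext_diff (fun y => f y * u y) x = f x *: ext_diff u x + u x *: ext_diff f x.
Proof.
move=> sf su Vx; apply/rowP => i; rewrite [LHS]mxE [RHS]mxE.
rewrite [X in _ = X + _]mxE [X in _ = _ + X]mxE.
rewrite [X in _ = _ * X + _]mxE [X in _ = _ + _ * X]mxE partialM.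
- by rewrite addrC [partial i f x * _]mulrC.
- exact: smooth_diff sf Vx.
- exact: smooth_diff su Vx.
Qed.

Lemma ext_diff_cst (c : R) x : ext_diff (fun=> c) x = 0 :> 'rV[R]_n.
Proof. by apply/rowP => i; rewrite [LHS]mxE [RHS]mxE partial_cst. Qed.

Lemma ext_diff_ext f u x : V x -> (forall y, V y -> f y = u y) ->
  ext_diff f x = ext_diff u x.
Proof.
move=> Vx fu; apply/rowP => i; rewrite [LHS]mxE [RHS]mxE.
exact: (partial_ext i oV fu Vx).
Qed.

Lemma wlap_ext a f u x : V x -> (forall y, V y -> f y = u y) -> wlap a f x = wlap a u x.
Proof.
move=> Vx fu; rewrite /wlap; congr (- _); apply: wdiv_ext => // y Vy.
by rewrite (ext_diff_ext Vy fu).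
Qed.

Lemma wlapD a f u x : smooth_mx V a -> smooth_on V f -> smooth_on V u -> V x ->
  wlap a (fun y => f y + u y) x = wlap a f x + wlap a u x.
Proof.
move=> sa sf su Vx; rewrite /wlap -opprD; congr (- _).
have sY v : smooth_on V v -> smooth_mx V (fun y => ext_diff v y *m a y).
  by move=> sv; apply: smooth_mxM => //; exact: smooth_ext_diff.
rewrite -wdivD //; [|exact: sY..]; apply: wdiv_ext => // y Vy.
by rewrite ext_diffD // mulmxDl.
Qed.

(** A second order operator without zeroth order term obeys the Leibniz rule
    up to its polarized symbol. *)
Lemma wlapM a f u x : smooth_mx V a -> (forall y, V y -> (a y)^T = a y) ->
  smooth_on V f -> smooth_on V u -> V x ->
  wlap a (fun y => f y * u y) x =
  f x * wlap a u x + u x * wlap a f x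
  - 2 * along (fun y => ext_diff f y *m a y) u x.
Proof.
move=> sa asym sf su Vx; rewrite /wlap.
have sY v : smooth_on V v -> smooth_mx V (fun y => ext_diff v y *m a y).
  by move=> sv; apply: smooth_mxM => //; exact: smooth_ext_diff.
have e y : V y -> ext_diff (fun z => f z * u z) y *m a y =
    f y *: (ext_diff u y *m a y) + u y *: (ext_diff f y *m a y).
  by move=> Vy; rewrite ext_diffM // mulmxDl -!scalemxAl.
rewrite (wdiv_ext Vx e) wdivD //; last 2 first.
- exact: smooth_mxZ (sY _ su).
- exact: smooth_mxZ (sY _ sf).
rewrite !wdivZ //; [|exact: sY..].
have -> : along (fun y => ext_diff u y *m a y) f x =
          along (fun y => ext_diff f y *m a y) u x.
  by rewrite /along dotrC dotr_mulr asym.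
ring.
Qed.

(** Naturality of the divergence under flows, infinitesimally.  The second
    derivatives of the components match; the terms [jac W * jac Y] and those with
    the Hessian of [s] are symmetric in [W] and [Y] and cancel. *)
Lemma wdiv_bracket W Y x : smooth_mx V W -> smooth_mx V Y -> V x ->
  wdiv (bracket W Y) x = along W (wdiv Y) x - along Y (wdiv W) x.
Proof.
move=> sW sY Vx.
have dwdiv Z k : smooth_mx V Z -> partial k (wdiv Z) x =
    \sum_i mx_partial k (mx_partial i Z) x 0 i
    + n%:R * \sum_i (hess s x k i * Z x 0 i + ext_diff s x 0 i * jac Z x k i).
  move=> sZ; rewrite /wdiv partialD; last 2 first.
  - apply: (smooth_diff (U := V)) => //; apply: smooth_sum => // i.
    exact: (smooth_jac sZ).
  - apply: (smooth_diff (U := V)) => //; apply: smoothM => //.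
      exact: smooth_cst.
    by apply: smooth_dotr => //; exact: smooth_ext_diff.
  rewrite (partial_sum oV _ k Vx); last by move=> i; exact: (smooth_jac sZ).
  congr (_ + _).
    apply: eq_bigr => i _; rewrite [RHS]mx_partialE.
    by congr (partial k _ x); apply/funext => y; rewrite jacE.
  rewrite partialM ?partial_cst ?mul0r ?add0r; last 2 first.
  - exact: smooth_diff (smooth_cst oV _) Vx.
  - apply: (smooth_diff (U := V)) => //.
    by apply: smooth_dotr => //; exact: smooth_ext_diff.
  congr (_ * _); rewrite (partial_sum oV _ k Vx); last first.
    by move=> i; apply: smoothM => //; exact: smooth_ext_diff.
  apply: eq_bigr => i _; rewrite partialM; last 2 first.
  - exact: smooth_diff (smooth_ext_diff oV ss 0 i) Vx.
  - exact: smooth_diff (sZ 0 i) Vx.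
  rewrite jacE mx_partialE hessE; congr (_ * _ + _).
  by congr (partial k _ x); apply/funext => y; rewrite mxE.
have dmul Z T i : smooth_mx V Z -> smooth_mx V T ->
    mx_partial i (fun y => Z y *m jac T y) x 0 i =
    \sum_k (jac Z x i k * jac T x k i
            + Z x 0 k * mx_partial k (mx_partial i T) x 0 i).
  move=> sZ sT; rewrite (mx_partialM oV i Vx sZ (smooth_jac sT)).
  rewrite [LHS]mxE [X in X + _]mxE [X in _ + X]mxE -big_split.
  apply: eq_bigr => k _ /=; rewrite [jac Z x i k]jacE; congr (_ + _ * _).
  rewrite (mx_partialC oV k i sT Vx) mx_partialE [RHS]mx_partialE.
  by congr (partial i _ x); apply/funext => y; rewrite jacE.
have smul Z T : smooth_mx V Z -> smooth_mx V T ->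
    smooth_mx V (fun y => Z y *m jac T y).
  by move=> sZ sT; apply: smooth_mxM => //; exact: smooth_jac.
have E Z T : smooth_mx V Z -> smooth_mx V T ->
    wdiv (fun y => Z y *m jac T y) x =
    \sum_i \sum_k jac Z x i k * jac T x k i + along Z (wdiv T) x
    - n%:R * \sum_i \sum_k Z x 0 k * hess s x k i * T x 0 i.
  move=> sZ sT; rewrite /wdiv /along.
  have -> : \tr (jac (fun y => Z y *m jac T y) x) =
      \sum_i \sum_k jac Z x i k * jac T x k i
      + \sum_i \sum_k Z x 0 k * mx_partial k (mx_partial i T) x 0 i.
    rewrite -big_split; apply: eq_bigr => i _ /=.
    by rewrite jacE dmul // big_split.
  rewrite -!addrA; congr (_ + _).
  have -> : dotr (Z x) (ext_diff (wdiv T) x) =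
    \sum_i \sum_k Z x 0 k * mx_partial k (mx_partial i T) x 0 i
    + n%:R * \sum_i \sum_k (Z x 0 k * hess s x k i * T x 0 i
        + Z x 0 k * (ext_diff s x 0 i * jac T x k i)).
    rewrite [X in _ = X + _]exchange_big [X in _ = _ + _ * X]exchange_big /=.
    rewrite mulr_sumr -big_split; apply: eq_bigr => k _ /=.
    rewrite [ext_diff _ _ _ _]mxE dwdiv // mulrDr; congr (_ + _).
      by rewrite mulr_sumr.
    rewrite mulrCA; congr (_ * _); rewrite mulr_sumr; apply: eq_bigr => i _.
    by rewrite mulrDr; congr (_ + _); exact: mulrA.
  rewrite -!addrA; congr (_ + _).
  under [X in _ = _ * X - _]eq_bigr => i _ do rewrite big_split /=.
  rewrite big_split /= -mulrBr [X in X - _]addrC addrK; congr (_ * _).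
  apply: eq_bigr => i _; rewrite [X in _ * X]mxE mulr_sumr.
  by apply: eq_bigr => k _; rewrite mulrCA.
have -> : wdiv (bracket W Y) x =
    wdiv (fun y => W y *m jac Y y) x - wdiv (fun y => Y y *m jac W y) x.
  rewrite /bracket wdivD //; [|exact: smul|exact/smooth_mxN/smul].
  congr (_ + _).
  rewrite (wdiv_ext (Y := fun y => -1 *: (Y y *m jac W y)) Vx); last first.
    by move=> y _; rewrite scaleN1r.
  rewrite wdivZ //; [|exact: smooth_cst|exact: smul].
  rewrite mulN1r /along ext_diff_cst dotrE trmx0 mulmx0.
  by rewrite [X in _ + X]mxE addr0.
rewrite !E //.
have -> : \sum_i \sum_k jac Y x i k * jac W x k i =
          \sum_i \sum_k jac W x i k * jac Y x k i.
  rewrite exchange_big; apply: eq_bigr => i _; apply: eq_bigr => k _ /=.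
  by rewrite mulrC.
have -> : \sum_i \sum_k Y x 0 k * hess s x k i * W x 0 i =
          \sum_i \sum_k W x 0 k * hess s x k i * Y x 0 i.
  rewrite exchange_big; apply: eq_bigr => i _; apply: eq_bigr => k _ /=.
  rewrite !hessE (partialC k i oV ss Vx).
  by rewrite [LHS]mulrC -[RHS]mulrA; congr (_ * _); exact: mulrC.
move: (\sum_i _) (along _ _ _) (along _ _ _) (\sum_i _) => A B C D.
ring.
Qed.

(** The Leibniz rule for the Lie derivative along [W] of [a] contracted with
    [du], which commutes with the exterior derivative. *)
Lemma bracket_grad W a u x : smooth_mx V W -> smooth_mx V a ->
  (forall y, V y -> (a y)^T = a y) -> smooth_on V u -> V x ->
  bracket W (fun y => ext_diff u y *m a y) x =
  ext_diff u x *m lie W a x + ext_diff (along W u) x *m a x.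
Proof.
move=> sW sa asym su Vx; rewrite /bracket /lie.
have -> : W x *m jac (fun y => ext_diff u y *m a y) x =
    W x *m hess u x *m a x
    + ext_diff u x *m \sum_k W x 0 k *: mx_partial k a x.
  apply/rowP => i; rewrite [LHS]mxE [RHS]mxE -mulmxA [X in _ = X + _]mxE.
  rewrite mulmx_sumr summxE -big_split; apply: eq_bigr => k _ /=.
  rewrite jacE (mx_partialM oV k Vx (smooth_ext_diff oV su) sa).
  rewrite [X in _ * X]mxE mulrDr; congr (_ + _).
    rewrite [X in _ * X]mxE [X in _ = _ * X]mxE; congr (_ * _).
    apply: eq_bigr => j _; congr (_ * _); rewrite mx_partialE hessE.
    by congr (partial k _ x); apply/funext => y; rewrite mxE.
  by rewrite -scalemxAr [RHS]mxE.
have -> : ext_diff (along W u) x =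
    ext_diff u x *m (jac W x)^T + W x *m hess u x.
  apply/rowP => i; rewrite [LHS]mxE [RHS]mxE [X in _ = X + _]mxE.
  rewrite [X in _ = _ + X]mxE -big_split /along /dotr.
  have sdu := smooth_ext_diff oV su.
  rewrite (partial_sum oV _ i Vx); last by move=> k; exact: smoothM.
  apply: eq_bigr => k _ /=; rewrite partialM; last 2 first.
  - exact: smooth_diff (sW 0 k) Vx.
  - exact: smooth_diff (sdu 0 k) Vx.
  congr (_ + _ * _).
    by rewrite mulrC [X in _ = _ * X]mxE jacE mx_partialE.
  rewrite hessE (partialC k i oV su Vx).
  by congr (partial i _ x); apply/funext => y; rewrite mxE.
rewrite mulmxBr mulmxDr mulmxDl !mulmxA.
move: (_ *m hess _ _ *m _) (_ *m \sum_k _) => A B.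
move: (_ *m jac _ _) (_ *m (jac _ _)^T *m _) => C D.
by apply/matrixP => p q; rewrite !mxE; ring.
Qed.

Section DoubleCommutator.
Variables (a b : 'rV[R]_n -> 'M[R]_n) (phi : 'rV[R]_n -> R).
Hypotheses (sa : smooth_mx V a) (sb : smooth_mx V b).
Hypotheses (asym : forall y, V y -> (a y)^T = a y).
Hypotheses (bsym : forall y, V y -> (b y)^T = b y).
Hypothesis sphi : smooth_on V phi.

Definition comm1 u x := wlap b (fun y => phi y * u y) x - phi x * wlap b u x.

Definition comm2 u x := wlap a (comm1 u) x - comm1 (wlap a u) x.

Let W y := ext_diff phi y *m b y.
Let sW : smooth_mx V W.
Proof. by apply: smooth_mxM => //; exact: smooth_ext_diff. Qed.

Let comm1E u x : smooth_on V u -> V x ->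
  comm1 u x = wlap b phi x * u x - 2 * along W u x.
Proof.
move=> su Vx; rewrite /comm1 wlapM // -/W.
move: (wlap b u x) (wlap b phi x) (along W u x) => p q r; ring.
Qed.

(** [wdiv_bracket] and [bracket_grad] move the derivative along [W] through
    [wlap a]; the third order terms and those with [wlap a (along W u)]
    cancel. *)
Let comm2E u x : smooth_on V u -> V x ->
  comm2 u x = wlap a (wlap b phi) x * u x
              - 2 * wdiv (fun y => ext_diff u y *m lie W a y) x.
Proof.
move=> su Vx; rewrite /comm2.
have sf : smooth_on V (wlap b phi) by exact: smooth_wlap.
have sWu : smooth_on V (along W u) by exact: smooth_along.
have sau : smooth_on V (wlap a u) by exact: smooth_wlap.
have c y : V y -> comm1 u y = wlap b phi y * u y + (-2) * along W u y.
  by move=> Vy; rewrite comm1E // mulNr.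
rewrite comm1E // (wlap_ext a Vx c).
rewrite wlapD //; [|exact: smoothM|by apply: smoothM => //; exact: smooth_cst].
rewrite wlapM // wlapM //; last exact: smooth_cst.
have wlap2 : wlap a (fun=> -2) x = 0.
  rewrite /wlap (wdiv_ext (Y := fun=> 0) Vx) ?wdiv0 ?oppr0 // => y _.
  by rewrite ext_diff_cst mul0mx.
have al2 : along (fun y => ext_diff (fun=> -2) y *m a y) (along W u) x = 0.
  by rewrite /along ext_diff_cst mul0mx dotrC dotrE trmx0 mulmx0 mxE.
rewrite wlap2 al2.
pose Y y := ext_diff u y *m a y.
have sY : smooth_mx V Y by apply: smooth_mxM => //; exact: smooth_ext_diff.
have alN Z f : smooth_on V f -> along Z (fun y => - f y) x = - along Z f x.
  move=> sfp; rewrite /along (ext_diff_ext (u := fun y => -1 * f y) Vx); last first.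
    by move=> y _; rewrite mulN1r.
  rewrite ext_diffM //; last exact: smooth_cst.
  by rewrite ext_diff_cst scaler0 addr0 dotrZr mulN1r.
have e1 : along W (wlap a u) x = - along W (wdiv Y) x.
  by apply: alN; exact: smooth_wdiv.
have e2 : along (fun y => ext_diff (wlap b phi) y *m a y) u x = - along Y (wdiv W) x.
  rewrite -alN; last exact: smooth_wdiv.
  by rewrite /along dotrC dotr_mulr asym.
have slie : smooth_mx V (lie W a) by exact: smooth_lie.
have e3 : along W (wdiv Y) x - along Y (wdiv W) x =
    wdiv (fun y => ext_diff u y *m lie W a y) x - wlap a (along W u) x.
  rewrite -wdiv_bracket //.
  have br y : V y -> bracket W Y y =
      ext_diff u y *m lie W a y + ext_diff (along W u) y *m a y.
    by move=> Vy; exact: bracket_grad.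
  rewrite (wdiv_ext Vx br) wdivD // ?opprK //.
  - by apply: smooth_mxM => //; exact: smooth_ext_diff.
  - by apply: smooth_mxM => //; exact: smooth_ext_diff.
rewrite e1 e2; have -> : wdiv (fun y => ext_diff u y *m lie W a y) x =
    along W (wdiv Y) x - along Y (wdiv W) x + wlap a (along W u) x.
  by rewrite e3 subrK.
move: (along W (wdiv Y) x) (along Y (wdiv W) x) (wlap a (along W u) x) => p q r.
move: (wlap b phi x) (wlap a u x) (u x) (wlap a (wlap b phi) x) (along W u x) => d e f g h.
ring.
Qed.

(** The double commutator of two such operators with a function is again a
    second order operator; being symmetric for the volume form, it is
    determined, up to a zeroth order term, by its principal symbol, which is a
    Lie derivative. *)
Lemma double_commutator u x : smooth_on V u -> V x ->
  comm2 u x - comm2 (fun=> 1) x * u x =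
  - 2 * wdiv (fun y => ext_diff u y *m lie (fun y => ext_diff phi y *m b y) a y) x.
Proof.
move=> su Vx; have s1 : smooth_on V (fun=> 1) by exact: smooth_cst.
rewrite !comm2E // (wdiv_ext (Y := fun=> 0) Vx (W := fun y => ext_diff (fun=> 1) y *m _)).
  rewrite wdiv0 -/W; move: (wdiv _ x) (wlap _ _ x) (u x) => p q r; ring.
by move=> y _; rewrite ext_diff_cst mul0mx.
Qed.

End DoubleCommutator.
End VectorFields.

(** * Pointwise algebra of powers of the Schouten tensor *)

Section TriangularSums.
Variables (V : nmodType).

Lemma triangle_swap M (F : nat -> nat -> V) :
  \sum_(p < M) \sum_(q < M.-1 - p) F p q = \sum_(q < M) \sum_(p < M.-1 - q) F p q.
Proof.
have widen (G : nat -> nat -> V) (p : 'I_M) :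
    \sum_(q < M.-1 - p) G p q = \sum_(q < M | (p + q < M.-1)%N) G p q.
  rewrite (big_ord_widen M (G p)); last first.
    by apply: leq_trans (leq_subr _ _) (leq_pred _).
  by apply: eq_bigl => q; rewrite ltn_subRL.
under eq_bigr => p _ do rewrite widen.
under [RHS]eq_bigr => q _ do rewrite (widen (fun q p => F p q)).
rewrite (exchange_big_dep xpredT) //=; apply: eq_bigr => q _.
by apply: eq_bigl => p; rewrite addnC.
Qed.

Lemma sum_rev M (F : nat -> V) : \sum_(p < M) F p = \sum_(p < M) F (M.-1 - p)%N.
Proof.
rewrite (reindex_inj rev_ord_inj); apply: eq_bigr => p _ /=.
by rewrite -subn1 -subnDA add1n.
Qed.

End TriangularSums.

(** Both sides are sums over all [p + q + r = M - 2]; the coefficient of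
    [c p q r] is [q + r + 2] in the first and, after the exchange of the last
    two arguments, [(q + 1) + (r + 1)] in the second. *)
Lemma cubic_cancellation (R : realType) (V : lmodType R) M
    (c : nat -> nat -> nat -> V) :
  \sum_(L < M) L.+1%:R *: \sum_(a < L) c (M.-1 - L)%N a (L.-1 - a)%N =
  \sum_(L < M) L.+1%:R *: \sum_(a < M.-1 - L)
     (c a L ((M.-1 - L).-1 - a)%N + c a ((M.-1 - L).-1 - a)%N L).
Proof.
rewrite (sum_rev M (fun L => L.+1%:R *: \sum_(a < L) c (M.-1 - L)%N a (L.-1 - a)%N)).
under [RHS]eq_bigr => L _ do rewrite big_split scalerDr !scaler_sumr.
rewrite big_split /=.
rewrite (triangle_swap M (fun L a => L.+1%:R *: c a L ((M.-1 - L).-1 - a)%N)).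
rewrite (triangle_swap M (fun L a => L.+1%:R *: c a ((M.-1 - L).-1 - a)%N L)).
rewrite -big_split; apply: eq_bigr => p _ /=.
have pM : (p <= M.-1)%N by have := ltn_ord p; lia.
rewrite (sum_rev _ (fun q => q.+1%:R *: c p ((M.-1 - q).-1 - p)%N q)) -big_split /=.
rewrite scaler_sumr; apply: eq_bigr => q _.
have qM : (q < M.-1 - p)%N by [].
have -> : (M.-1 - (M.-1 - p) = p)%N by lia.
have -> : ((M.-1 - p).-1 - q = (M.-1 - q).-1 - p)%N by lia.
have -> : ((M.-1 - ((M.-1 - q).-1 - p)).-1 - p = q)%N by lia.
rewrite -scalerDl -natrD; congr (_%:R *: _); lia.
Qed.

Section PointwiseAlgebra.
Variables (R : realType) (n : nat).
Local Notation mx := 'M[R]_n.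
Implicit Types (d v w : 'rV[R]_n) (P Q B : mx).

(** Bracketing with [B] is a derivation; the sum telescopes. *)
Lemma commutator_exp B P N :
  \sum_(a < N) P ^+ a *m (B *m P - P *m B) *m P ^+ (N.-1 - a) =
  B *m P ^+ N - P ^+ N *m B.
Proof.
transitivity (\sum_(0 <= a < N) (P ^+ a *m B *m P ^+ (N - a) -
    P ^+ a.+1 *m B *m P ^+ (N - a.+1))).
  rewrite big_mkord; apply: eq_bigr => a _.
  have -> : (N - a = (N.-1 - a).+1)%N by have := ltn_ord a; lia.
  have -> : (N - a.+1 = N.-1 - a)%N by lia.
  by rewrite exprS exprSr -!mulmxE mulmxBr mulmxBl !mulmxA.
rewrite -[LHS]opprK -sumrN; under eq_bigr => a _ do rewrite opprB.
rewrite (telescope_sumr (fun a => P ^+ a *m B *m P ^+ (N - a))) //.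
by rewrite subnn subn0 !expr0 opprB mulmx1 mul1mx.
Qed.

(** [P] stands for the Schouten tensor, [C k] for its covariant derivative, [d]
    for the differential of the conformal factor, [v] for that of the multiplier
    and [- Q] for the covariant Hessian of the multiplier. *)
Variables (P Q : mx) (C : 'I_n -> mx) (d v : 'rV[R]_n).
Hypotheses (Psym : P^T = P) (Qsym : Q^T = Q).
Hypothesis Csym : forall k, (C k)^T = C k.
Hypothesis Ccodazzi : forall k i j, C k i j = C i k j.

(** The trace-free part of the Christoffel matrix of the conformally flat metric
    in the direction [k], which is skew. *)
Definition wedge_e (k : 'I_n) : mx := (delta_mx 0 k)^T *m d - d^T *m delta_mx 0 k.

(** The covariant derivative of [P ^+ N]. *)
Definition dpow N k : mx := \sum_(a < N) P ^+ a *m C k *m P ^+ (N.-1 - a).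

(** The difference between partial and covariant derivative is a derivation
    plus a multiple of the degree, so it passes from [P] to [P ^+ N]. *)
Lemma dpow_flat N k (dP : mx) :
  dP = C k + (2 * d 0 k) *: P - (wedge_e k *m P - P *m wedge_e k) ->
  \sum_(a < N) P ^+ a *m dP *m P ^+ (N.-1 - a) =
  dpow N k + (2 * N%:R * d 0 k) *: P ^+ N - (wedge_e k *m P ^+ N - P ^+ N *m wedge_e k).
Proof.
move=> ->; rewrite -commutator_exp /dpow.
have -> : (2 * N%:R * d 0 k) *: P ^+ N =
    \sum_(a < N) P ^+ a *m ((2 * d 0 k) *: P) *m P ^+ (N.-1 - a).
  transitivity (\sum_(a < N) (2 * d 0 k) *: P ^+ N).
    rewrite sumr_const card_ord -[RHS]scaler_nat scalerA; congr (_ *: _); ring.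
  apply: eq_bigr => a _; rewrite -scalemxAr -scalemxAl; congr (_ *: _).
  rewrite !mulmxE -exprSr -exprD; congr (_ ^+ _); have := ltn_ord a; lia.
rewrite -big_split -sumrB; apply: eq_bigr => a _ /=.
have D (A X Y Z B : mx) : A *m (X + Y - Z) *m B =
    A *m X *m B + A *m Y *m B - A *m Z *m B.
  by rewrite mulmxBr mulmxDr mulmxBl mulmxDl.
exact: D.
Qed.

(** [expR (2 * N.+1 * s)] times the [k]-th derivative of
    [expR (- 2 * N.+1 * s) *: P ^+ N], where [d] is the differential of [s]. *)
Definition dalpha N k : mx :=
  dpow N k - (2 * d 0 k) *: P ^+ N - (wedge_e k *m P ^+ N - P ^+ N *m wedge_e k).

Definition rows (F : 'I_n -> 'rV[R]_n) : mx := \matrix_(k, j) F k 0 j.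

(** The Jacobian of the vector field [v *m alpha s N] and the Lie derivative of
    [alpha s L] along it, both without their exponential factors; the first
    factor of [jac_alpha] is the Euclidean Hessian of the multiplier. *)
Definition jac_alpha N : mx :=
  (v^T *m d + d^T *m v - dotr d v *: 1%:M - Q) *m P ^+ N
  + rows (fun k => v *m dalpha N k).

Definition lie_alpha L N : mx :=
  \sum_k (v *m P ^+ N) 0 k *: dalpha L k
  - (P ^+ L *m jac_alpha N + (jac_alpha N)^T *m P ^+ L).

Lemma trmxX (A : mx) N : (A ^+ N)^T = A^T ^+ N.
Proof.
elim: N => [|N IH]; first by rewrite !expr0 trmx1.
by rewrite exprS exprSr -!mulmxE trmx_mul IH.
Qed.

Let PXsym N : (P ^+ N)^T = P ^+ N.
Proof. by rewrite trmxX Psym. Qed.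

Lemma eq_rows F G : F =1 G -> rows F = rows G.
Proof. by move=> FG; apply/matrixP => k j; rewrite mxE [RHS]mxE FG. Qed.

Lemma rowsB F G : rows (fun k => F k - G k) = rows F - rows G.
Proof. by apply/matrixP => k j; rewrite !mxE. Qed.

Lemma rows_sum (I : Type) (r : seq I) (F : I -> 'I_n -> 'rV[R]_n) :
  rows (fun k => \sum_(a <- r) F a k) = \sum_(a <- r) rows (F a).
Proof.
apply/matrixP => k j; rewrite [LHS]mxE !summxE.
by apply: eq_bigr => a _; rewrite [RHS]mxE.
Qed.

Lemma rows_mulr F A : rows (fun k => F k *m A) = rows F *m A.
Proof.
apply/matrixP => k j; rewrite [LHS]mxE [LHS]mxE [RHS]mxE.
by apply: eq_bigr => i _; rewrite [X in _ = X * _]mxE.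
Qed.

Lemma rows_outer w r : rows (fun k => w 0 k *: r) = w^T *m r.
Proof. by apply/matrixP => k j; rewrite !mxE big_ord1 !mxE. Qed.

Lemma rows_delta c : rows (fun k => c *: delta_mx 0 k) = c *: 1%:M.
Proof. by apply/matrixP => k j; rewrite !mxE eqxx eq_sym. Qed.

Lemma rows_codazzi w : rows (fun k => w *m C k) = \sum_l w 0 l *: C l.
Proof.
apply/matrixP => k j; rewrite [LHS]mxE [LHS]mxE summxE.
by apply: eq_bigr => l _; rewrite Ccodazzi [RHS]mxE.
Qed.

Lemma mul_wedge_e w k : w *m wedge_e k = w 0 k *: d - dotr w d *: delta_mx 0 k.
Proof.
rewrite /wedge_e mulmxBr !mulmxA; congr (_ - _).
  rewrite [w *m _]mx11_scalar mul_scalar_mx trmx_delta -colE; congr (_ *: _).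
  by rewrite mxE.
by rewrite [w *m _]mx11_scalar mul_scalar_mx -dotrE.
Qed.

Lemma sum_wedge_e w : \sum_k w 0 k *: wedge_e k = w^T *m d - d^T *m w.
Proof.
rewrite [in w^T](row_sum_delta w) [X in _ = _ - _ *m X](row_sum_delta w).
rewrite linear_sum mulmx_suml mulmx_sumr -sumrB; apply: eq_bigr => k _ /=.
by rewrite linearZ /= -scalemxAl -scalemxAr -scalerBr.
Qed.

Let cubic a q r : mx := \sum_k (v *m P ^+ a) 0 k *: (P ^+ q *m C k *m P ^+ r).

Lemma sum_dpow N L : \sum_k (v *m P ^+ N) 0 k *: dpow L k =
  \sum_(a < L) cubic N a (L.-1 - a).
Proof.
rewrite exchange_big; apply: eq_bigr => k _ /=.
by rewrite scaler_sumr.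
Qed.

Lemma dpow_mxE N : rows (fun k => v *m dpow N k) =
  \sum_(a < N) (\sum_k (v *m P ^+ a) 0 k *: C k) *m P ^+ (N.-1 - a).
Proof.
transitivity (rows (fun k => \sum_(a < N) v *m P ^+ a *m C k *m P ^+ (N.-1 - a))).
  apply: eq_rows => k; rewrite mulmx_sumr; apply: eq_bigr => a _.
  by rewrite !mulmxA.
by rewrite rows_sum; apply: eq_bigr => a _; rewrite rows_mulr rows_codazzi.
Qed.

(** The derivative index of [C] is contracted with [P ^+ L] here; by the Codazzi
    symmetry it changes places with the slot of [v]. *)
Lemma mul_dpow_mx N L : P ^+ L *m rows (fun k => v *m dpow N k) =
  \sum_(a < N) cubic a L (N.-1 - a).
Proof.
rewrite dpow_mxE mulmx_sumr; apply: eq_bigr => a _.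
rewrite mulmxA mulmx_sumr mulmx_suml; apply: eq_bigr => k _.
by rewrite -scalemxAr -scalemxAl.
Qed.

Lemma tr_mul_dpow_mx N L : (rows (fun k => v *m dpow N k))^T *m P ^+ L =
  \sum_(a < N) cubic a (N.-1 - a) L.
Proof.
rewrite -[LHS]trmxK trmx_mul trmxK PXsym mul_dpow_mx linear_sum.
apply: eq_bigr => a _; rewrite linear_sum; apply: eq_bigr => k _ /=.
by rewrite linearZ /= !trmx_mul !PXsym Csym mulmxA.
Qed.

(** A Lie derivative does not see the difference between partial and covariant
    derivatives, so all terms containing [d] cancel. *)
Lemma lie_alphaE L N :
  lie_alpha L N = P ^+ L *m Q *m P ^+ N + P ^+ N *m Q *m P ^+ L
  + (\sum_k (v *m P ^+ N) 0 k *: dpow L k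
     - (P ^+ L *m rows (fun k => v *m dpow N k)
        + (rows (fun k => v *m dpow N k))^T *m P ^+ L)).
Proof.
set w := v *m P ^+ N; set Z := rows _; set o := dotr w d.
have jE : jac_alpha N = - (Q *m P ^+ N) - (d^T *m w - w^T *m d) - o *: 1%:M + Z.
  rewrite /jac_alpha.
  have -> : rows (fun k => v *m dalpha N k) =
      Z - 2 *: (d^T *m w) - (v^T *m (d *m P ^+ N) - dotr v d *: P ^+ N
                             - (w^T *m d - o *: 1%:M)).
    transitivity (rows (fun k => v *m dpow N k - (d 0 k *: (2 *: w))
        - (v 0 k *: (d *m P ^+ N) - (dotr v d *: delta_mx 0 k) *m P ^+ N
           - (w 0 k *: d - o *: delta_mx 0 k)))).
      have D (A B X Y : mx) : v *m (A - B - (X - Y)) =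
          v *m A - v *m B - (v *m X - v *m Y) by rewrite !mulmxBr.
      apply: eq_rows => k; rewrite /dalpha D -scalemxAr -/w scalerA.
      rewrite [v *m (wedge_e k *m _)]mulmxA mul_wedge_e mulmxBl -!scalemxAl.
      by rewrite [v *m (_ *m wedge_e k)]mulmxA mul_wedge_e [2 * _]mulrC.
    rewrite (rowsB _ (fun k => v 0 k *: (d *m P ^+ N)
        - (dotr v d *: delta_mx 0 k) *m P ^+ N - (w 0 k *: d - o *: delta_mx 0 k))).
    rewrite (rowsB _ (fun k => d 0 k *: (2 *: w))).
    rewrite (rowsB _ (fun k => w 0 k *: d - o *: delta_mx 0 k)).
    rewrite (rowsB _ (fun k => (dotr v d *: delta_mx 0 k) *m P ^+ N)).
    rewrite (rowsB (fun k => w 0 k *: d)).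
    by rewrite rows_mulr !rows_outer !rows_delta -scalemxAl mul1mx -scalemxAr.
  rewrite !mulmxBl mulmxDl -!mulmxA -/w -scalemxAl mul1mx [dotr d v]dotrC.
  have D (A B D E F G : mx) (c : R) : A + B - c *: F - E +
      (G - 2 *: B - (A - c *: F - (D - o *: 1%:M))) =
      - E - (B - D) - o *: 1%:M + G.
    by apply/matrixP => i j; rewrite !mxE; ring.
  exact: D.
have jtE : (jac_alpha N)^T =
    - (P ^+ N *m Q) + (d^T *m w - w^T *m d) - o *: 1%:M + Z^T.
  have D (A B F G : mx) (c : R) : (- A - (B - F) - c *: 1%:M + G)^T =
      - A^T + (F^T - B^T) - c *: 1%:M + G^T.
    by apply/matrixP => i j; rewrite !mxE (eq_sym i j); ring.
  rewrite jE D (trmx_mul Q) (trmx_mul d^T) (trmx_mul w^T) !trmxK PXsym Qsym.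
  by [].
have sE : \sum_k w 0 k *: dalpha L k = \sum_k w 0 k *: dpow L k
    - (2 * o) *: P ^+ L - ((w^T *m d - d^T *m w) *m P ^+ L
                           - P ^+ L *m (w^T *m d - d^T *m w)).
  have -> : (2 * o) *: P ^+ L = \sum_k w 0 k *: ((2 * d 0 k) *: P ^+ L).
    rewrite /o /dotr mulr_sumr scaler_suml; apply: eq_bigr => k _.
    by rewrite scalerA mulrCA.
  rewrite -sum_wedge_e mulmx_suml mulmx_sumr -!sumrB; apply: eq_bigr => k _.
  by rewrite -scalemxAl -scalemxAr -!scalerBr.
rewrite /lie_alpha -/w sE jtE jE.
have D (S a K K' X Y F T : mx) (c : R) :
    S - (2 * c) *: a - ((K - K') *m a - a *m (K - K'))
    - (a *m (- X - (K' - K) - c *: 1%:M + F) + (- Y + (K' - K) - c *: 1%:M + T) *m a)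
    = a *m X + Y *m a + (S - (a *m F + T *m a)).
  rewrite !(mulmxDr, mulmxDl, mulmxBr, mulmxBl, mulmxN, mulNmx).
  rewrite -scalemxAl -scalemxAr mul1mx mulmx1.
  move: (K *m a) (K' *m a) (a *m K) (a *m K') (a *m X) (Y *m a) (a *m F) (T *m a).
  by move=> A B E G H I J U; apply/matrixP => i j; rewrite !mxE; ring.
by rewrite D mulmxA.
Qed.

(** The first derivatives cancel by symmetry, and the second derivatives of
    the multiplier collect with total weight [(L + 1) + (M - L)]. *)
Lemma sum_lie_alpha M : \sum_(L < M) L.+1%:R *: lie_alpha L (M.-1 - L) =
  M.+1%:R *: \sum_(L < M) P ^+ L *m Q *m P ^+ (M.-1 - L).
Proof.
under eq_bigr => L _ do rewrite lie_alphaE scalerDr.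
rewrite big_split /= [X in _ + X](_ : _ = 0) ?addr0.
  under eq_bigr => L _ do rewrite scalerDr.
  rewrite big_split /=.
  rewrite [X in _ + X](sum_rev M
    (fun L => L.+1%:R *: (P ^+ (M.-1 - L) *m Q *m P ^+ L))) -big_split /=.
  rewrite scaler_sumr; apply: eq_bigr => L _.
  have -> : (M.-1 - (M.-1 - L) = L)%N by have := ltn_ord L; lia.
  rewrite -scalerDl -natrD; congr (_%:R *: _); have := ltn_ord L; lia.
under eq_bigr => L _ do
  rewrite sum_dpow mul_dpow_mx tr_mul_dpow_mx -big_split scalerBr.
rewrite sumrB (cubic_cancellation M cubic) subrr //.
Qed.

End PointwiseAlgebra.

(** * The operators in a flat chart *)

Section FlatOperators.
Variables (R : realType) (n : nat) (V : set 'rV[R]_n).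
Hypothesis oV : open V.

(** The power [P^N] with both indices raised by the metric
    [expR (2 * s) *: 1%:M], where [N + 1] inverse metrics enter. *)
Definition alpha (s : 'rV[R]_n -> R) N (x : 'rV[R]_n) : 'M[R]_n :=
  expR (- (2 * N.+1%:R * s x)) *: flat_schouten s x ^+ N.

Section OneFactor.
Variable s : 'rV[R]_n -> R.
Hypothesis ss : smooth_on V s.

Lemma hess_sym f x : smooth_on V f -> V x -> (hess f x)^T = hess f x.
Proof.
move=> sf Vx; apply/matrixP => i j; rewrite mxE !hessE.
exact: partialC oV sf Vx.
Qed.

Lemma smooth_hess f : smooth_on V f -> smooth_mx V (hess f).
Proof.
move=> sf i j.
apply: (smooth_ext oV _ (smooth_partial i (smooth_partial j sf))) => x _.
by rewrite hessE.
Qed.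

Lemma smooth_flat_schouten : smooth_mx V (flat_schouten s).
Proof.
have sd := smooth_ext_diff oV ss.
apply: smooth_mxD => //; first apply: smooth_mxD => //.
- by apply: smooth_mxM => //; exact: smooth_mx_tr.
- exact/(smooth_mxN oV)/smooth_hess.
- apply: smooth_mxN => //.
  apply: (smooth_mx_ext oV (A := fun x =>
    (2^-1 * dotr (ext_diff s x) (ext_diff s x)) *: 1%:M)).
    by move=> x _; rewrite scalemx1.
  apply: smooth_mxZ => //; last exact: smooth_mx_cst.
  apply: smoothM => //; first exact: smooth_cst.
  exact: smooth_dotr.
Qed.

Lemma flat_schouten_sym x : V x -> (flat_schouten s x)^T = flat_schouten s x.
Proof.
move=> Vx; rewrite /flat_schouten !linearB /= trmx_mul trmxK hess_sym //.
by rewrite tr_scalar_mx.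
Qed.

Lemma smooth_alpha_exp N : smooth_on V (fun x => expR (- (2 * N.+1%:R * s x))).
Proof.
apply/smooth_exp/smoothN/smoothM => //; exact: smooth_cst.
Qed.

Lemma smooth_alpha N : smooth_mx V (alpha s N).
Proof.
apply: smooth_mxZ => //; first exact: smooth_alpha_exp.
exact/(smooth_mxX oV)/smooth_flat_schouten.
Qed.

Lemma alpha_sym N x : V x -> (alpha s N x)^T = alpha s N x.
Proof. by move=> Vx; rewrite /alpha linearZ /= trmxX flat_schouten_sym. Qed.

Hypothesis n3 : (2 < n)%N.

Let w N u y := hash (flat_metric s y) (schouten_pow (flat_metric s) N y) (ext_diff u y).

Lemma flat_hash N u y : V y ->
  w N u y = expR (2 * s y) *: (ext_diff u y *m alpha s N y).
Proof.
move=> Vy; rewrite /w /hash /sharp /schouten_pow mulmxA mulmxKV; last first.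
  exact: flat_metric_unit.
rewrite (flat_schoutenE oV ss n3 Vy) invmx_flat_metric -scalemxAl mul1mx.
have -> : (expR (- (2 * s y)) *: flat_schouten s y) ^+ N =
    expR (- (2 * N%:R * s y)) *: flat_schouten s y ^+ N.
  elim: N => [|N IH]; first by rewrite !expr0 mulr0 mul0r oppr0 expR0 scale1r.
  rewrite !exprS IH -!mulmxE -scalemxAl -scalemxAr scalerA -expRD; congr (expR _ *: _).
  by rewrite -[N.+1%:R]natr1; ring.
rewrite /alpha -!scalemxAr scalerA -expRD; congr (expR _ *: _).
by rewrite -[N.+1%:R]natr1; ring.
Qed.

Lemma smooth_flat_hash N u : smooth_on V u -> smooth_mx V (w N u).
Proof.
move=> su; apply: (smooth_mx_ext oV
  (A := fun y => expR (2 * s y) *: (ext_diff u y *m alpha s N y))).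
  by move=> y Vy; rewrite flat_hash.
apply: smooth_mxZ => //.
  by apply/smooth_exp/smoothM => //; exact: smooth_cst.
by apply: smooth_mxM => //; [exact: smooth_ext_diff|exact: smooth_alpha].
Qed.

(** The weight [n] of the divergence is [n - 2] from the trace of the Christoffel
    symbols plus [2] from raising the index of the 1-form. *)
Lemma flat_T_op N u x : smooth_on V u -> V x ->
  local_T_op N (flat_metric s) u x = wlap s (alpha s N) u x.
Proof.
move=> su Vx; rewrite /local_T_op -/(w N u) codiffE /wlap; congr (- _).
set Y := fun y => ext_diff u y *m alpha s N y.
have sY : smooth_mx V Y.
  by apply: smooth_mxM => //; [exact: smooth_ext_diff|exact: smooth_alpha].
rewrite invmx_flat_metric -scalemxAl mul1mx mxtraceZ mxtrace_tr.
pose E y := expR (2 * s y).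
have s2 : smooth_on V (fun y => 2 * s y) by apply: smoothM => //; exact: smooth_cst.
have sE : smooth_on V E by exact: smooth_exp.
have dE i : partial i E x = E x * (2 * partial i s x).
  rewrite partial_exp ?partialM ?partial_cst; last 3 first.
  - exact: smooth_diff (smooth_cst oV _) Vx.
  - exact: smooth_diff ss Vx.
  - exact: smooth_diff s2 Vx.
  by rewrite mul0r add0r.
have cE i : cov_diff (flat_metric s) (w N u) x i i =
    E x * (jac Y x i i + dotr (ext_diff s x) (Y x)).
  rewrite mxE (mx_partial_ext oV i Vx (flat_hash N u)) (mx_partialZ i Vx sE sY).
  rewrite flat_hash // (flat_conn oV ss i Vx) dE -scalemxAl -scalerA -scalerDr -scalerBr.
  rewrite [LHS]mxE; congr (_ * _).
  have EM (A B : 'rV[R]_n) : (A - B) 0 i = A 0 i - B 0 i by rewrite !mxE.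
  rewrite EM [X in X - _]mxE [X in X + _ - _]mxE jacE.
  have -> : (Y x *m (\matrix_(j, k) gam (fun a => partial a s x) k i j)^T) 0 i
     = 2 * partial i s x * Y x 0 i - dotr (ext_diff s x) (Y x).
    rewrite mxE /dotr -(sum_delta i (fun k => 2 * partial i s x * Y x 0 k)) -sumrB.
    apply: eq_bigr => k _; rewrite [X in _ * X]mxE [X in _ * X]mxE.
    rewrite [ext_diff _ _ _ _]mxE /gam eqxx mul1r.
    move: (partial i s x) (partial k s x) (Y x 0 k) (_%:R) => p q r t; ring.
  move: (mx_partial _ _ _ _ _) (_ * _ * Y x 0 i) (dotr _ _) => p q r; ring.
rewrite /mxtrace (eq_bigr _ (fun i _ => cE i)) -mulr_sumr big_split /= sumr_const.
rewrite card_ord /E mulrA -expRD addNr expR0 mul1r /wdiv mulr_natl.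
by [].
Qed.

End OneFactor.
End FlatOperators.

(** * Codazzi symmetry and the Lie derivatives of powers *)

Section CodazziAlgebra.
Variables (R : realType) (n : nat).
Variables (d : 'rV[R]_n) (H : 'M[R]_n) (T : 'I_n -> 'M[R]_n).
Hypotheses (Hsym : H^T = H) (Tsym : forall k i j, T k i j = T i k j).

Let P : 'M[R]_n := d^T *m d - H - (2^-1 * dotr d d)%:M.
Let h k : 'rV[R]_n := delta_mx 0 k *m H.

Let mul_dP : d *m P = (2^-1 * dotr d d) *: d - d *m H.
Proof.
rewrite /P !mulmxBr mulmxA [d *m d^T]mx11_scalar mul_scalar_mx -dotrE.
rewrite mul_mx_scalar addrAC -scalerBl; congr (_ *: _ - _); lra.
Qed.

Let dH_dot k : dotr d (h k) = (d *m H) 0 k.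
Proof.
rewrite dotrE trmx_mul Hsym mulmxA trmx_delta -colE.
by rewrite mxE.
Qed.

(** Skew-symmetrizing in the first two indices leaves third derivatives out,
    and the remaining terms cancel. *)
Lemma codazzi_algebra k i j :
  let C k := (h k)^T *m d + d^T *m h k - T k - (dotr d (h k))%:M
             - (2 * d 0 k) *: P + (wedge_e d k *m P - P *m wedge_e d k) in
  C k i j = C i k j.
Proof.
move=> C.
have Psym : P^T = P.
  by rewrite /P !linearB /= trmx_mul trmxK Hsym tr_scalar_mx.
have hE a b : h a 0 b = H a b by rewrite /h -rowE mxE.
have PE a b : P a b = d 0 a * d 0 b - H a b - (a == b)%:R * (2^-1 * dotr d d).
  rewrite /P; have E (A B : 'M[R]_n) c : (A - B - c%:M) a b =
    A a b - B a b - (a == b)%:R * c by rewrite !mxE mulr_natl.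
  by rewrite E mxE big_ord1 mxE.
have oE (r r' : 'rV[R]_n) a b : (r^T *m r') a b = r 0 a * r' 0 b.
  by rewrite mxE big_ord1 mxE.
have eE a b : (delta_mx 0 a : 'rV[R]_n) 0 b = (b == a)%:R by rewrite mxE eqxx.
have rP a : wedge_e d a *m P = (delta_mx 0 a)^T *m (d *m P) - d^T *m (delta_mx 0 a *m P).
  by rewrite /wedge_e mulmxBl !mulmxA.
have Pr a : P *m wedge_e d a = (delta_mx 0 a *m P)^T *m d - (d *m P)^T *m delta_mx 0 a.
  by rewrite /wedge_e mulmxBr !mulmxA !trmx_mul Psym.
have ePE a b : ((delta_mx 0 a : 'rV[R]_n) *m P) 0 b = P a b by rewrite -rowE mxE.
have CE a b : C a b j = H a b * d 0 j + d 0 b * H a j - T a b j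
    - (b == j)%:R * (d *m H) 0 a - 2 * d 0 a * P b j
    + ((b == a)%:R * (d *m P) 0 j - d 0 b * P a j
       - (P a b * d 0 j - (d *m P) 0 b * (j == a)%:R)).
  rewrite /C rP Pr; have E (A B D F G I J K : 'M[R]_n) (c e : R) :
    (A + B - D - c%:M - e *: F + (G - I - (J - K))) b j =
    A b j + B b j - D b j - (b == j)%:R * c - e * F b j
    + (G b j - I b j - (J b j - K b j)) by rewrite !mxE mulr_natl.
  by rewrite E !oE !hE dH_dot !eE !ePE.
have Hc a b : H a b = H b a by rewrite -[in LHS]Hsym mxE.
have dPE b : (d *m P) 0 b = 2^-1 * dotr d d * d 0 b - (d *m H) 0 b.
  by rewrite mul_dP !mxE.
rewrite !CE !dPE !PE Tsym (Hc i k) (eq_sym i k) (eq_sym j i) (eq_sym j k).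
move: (H k i) (H k j) (H i j) (T i k j) (d 0 k) (d 0 i) (d 0 j) (dotr d d).
move: ((d *m H) 0 k) ((d *m H) 0 i) ((d *m H) 0 j) ((k == i)%:R) ((k == j)%:R) ((i == j)%:R).
by move=> ? ? ? ? ? ? ? ? ? ? ? ? ? ?; field.
Qed.

End CodazziAlgebra.

Section LieDerivatives.
Variables (R : realType) (n : nat) (V : set 'rV[R]_n).
Variables (s phi : 'rV[R]_n -> R).
Hypotheses (oV : open V) (ss : smooth_on V s) (sphi : smooth_on V phi).

(** The covariant derivative of the Schouten tensor, in the [k]-th direction,
    for the metric [expR (2 * s) *: 1%:M]; see [dpow_flat]. *)
Definition cotton (k : 'I_n) (x : 'rV[R]_n) : 'M[R]_n :=
  mx_partial k (flat_schouten s) x - (2 * ext_diff s x 0 k) *: flat_schouten s x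
  + (wedge_e (ext_diff s x) k *m flat_schouten s x
     - flat_schouten s x *m wedge_e (ext_diff s x) k).

(** Minus the Hessian of [phi] for the metric [expR (2 * s) *: 1%:M]; by
    [flat_schouten_deformed] it is the derivative of the Schouten tensor. *)
Definition schouten_variation (x : 'rV[R]_n) : 'M[R]_n :=
  (ext_diff phi x)^T *m ext_diff s x + (ext_diff s x)^T *m ext_diff phi x
  - dotr (ext_diff s x) (ext_diff phi x) *: 1%:M - hess phi x.

Lemma mx_partial_ext_diff (f : 'rV[R]_n -> R) k x :
  mx_partial k (ext_diff f) x = delta_mx 0 k *m hess f x.
Proof.
apply/rowP => j; rewrite -rowE [RHS]mxE hessE mx_partialE.
by congr (partial k _ x); apply/funext => y; rewrite mxE.
Qed.

Lemma mx_partial_schouten k x : V x -> mx_partial k (flat_schouten s) x =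
  (delta_mx 0 k *m hess s x)^T *m ext_diff s x
  + (ext_diff s x)^T *m (delta_mx 0 k *m hess s x)
  - mx_partial k (hess s) x
  - (dotr (ext_diff s x) (delta_mx 0 k *m hess s x))%:M.
Proof.
move=> Vx.
have sd := smooth_ext_diff oV ss.
have sdt := smooth_mx_tr oV sd.
have so := smooth_mxM oV sdt sd.
have sh := smooth_hess oV ss.
have sq : smooth_on V (fun y => 2^-1 * dotr (ext_diff s y) (ext_diff s y)).
  by apply: smoothM => //; [exact: smooth_cst|exact: smooth_dotr].
have sq1 : smooth_mx V (fun y => (2^-1 * dotr (ext_diff s y) (ext_diff s y)) *: (1%:M : 'M[R]_n)).
  exact: (smooth_mxZ oV sq (smooth_mx_cst oV _)).
transitivity (mx_partial k (fun y => (ext_diff s y)^T *m ext_diff s y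
   + - hess s y + - ((2^-1 * dotr (ext_diff s y) (ext_diff s y)) *: 1%:M)) x).
  by apply: (mx_partial_ext oV k Vx) => y _; rewrite scalemx1.
rewrite (mx_partialD k Vx (smooth_mxD oV so (smooth_mxN oV sh)) (smooth_mxN oV sq1)).
rewrite (mx_partialD k Vx so (smooth_mxN oV sh)) (mx_partialN k Vx sh).
rewrite (mx_partialN k Vx sq1) (mx_partialM oV k Vx sdt sd) mx_partial_tr.
rewrite mx_partial_ext_diff (mx_partialZ k Vx sq (smooth_mx_cst oV _)).
rewrite mx_partial_cst scaler0 addr0 scalemx1; congr (_ - _%:M).
rewrite partialM; last 2 first.
- exact: smooth_diff (smooth_cst oV _) Vx.
- exact: smooth_diff (smooth_dotr oV sd sd) Vx.
rewrite partial_cst mul0r add0r /dotr (partial_sum oV _ k Vx); last first.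
  by move=> i; exact: smoothM.
rewrite mulr_sumr; apply: eq_bigr => i _.
have di : partial k (fun y => ext_diff s y 0 i) x =
    ((delta_mx 0 k : 'rV[R]_n) *m hess s x) 0 i.
  transitivity (mx_partial k (ext_diff s) x 0 i); first by rewrite mx_partialE.
  by rewrite mx_partial_ext_diff.
rewrite partialM; [|exact: smooth_diff (sd 0 i) Vx..].
rewrite !di; move: (ext_diff s x 0 i) ((_ *m _) 0 i) => p q; lra.
Qed.

(** This is the vanishing of the Cotton tensor of a conformally flat metric. *)
Lemma cotton_codazzi k i j x : V x -> cotton k x i j = cotton i x k j.
Proof.
move=> Vx; have Tsym a b c : mx_partial a (hess s) x b c = mx_partial b (hess s) x a c.
  have E l m : mx_partial l (hess s) x m c = partial l (partial m (partial c s)) x.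
    by rewrite mx_partialE; congr (partial l _ x); apply/funext => y; rewrite hessE.
  rewrite [LHS]E [RHS]E.
  exact: (partialC a b oV (smooth_partial c ss) Vx).
rewrite /cotton !mx_partial_schouten //.
exact: (@codazzi_algebra R n (ext_diff s x) (hess s x)
  (fun l => mx_partial l (hess s) x) (hess_sym oV ss Vx) Tsym k i j).
Qed.

Lemma cotton_sym k x : V x -> (cotton k x)^T = cotton k x.
Proof.
move=> Vx; rewrite /cotton.
have Ps := flat_schouten_sym oV ss Vx.
have dPs : (mx_partial k (flat_schouten s) x)^T = mx_partial k (flat_schouten s) x.
  rewrite -mx_partial_tr; apply: (mx_partial_ext oV k Vx) => y Vy.
  exact: (flat_schouten_sym oV ss Vy).
have rt : (wedge_e (ext_diff s x) k)^T = - wedge_e (ext_diff s x) k.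
  by rewrite /wedge_e linearB /= !trmx_mul !trmxK opprB.
have D (A P B : 'M[R]_n) c : A^T = A -> P^T = P -> B^T = - B ->
    (A - c *: P + (B *m P - P *m B))^T = A - c *: P + (B *m P - P *m B).
  move=> eA eP eB; rewrite linearD /= !linearB /= linearZ /= !trmx_mul eA eP eB.
  by rewrite mulmxN mulNmx opprK [- _ + _]addrC.
exact: D.
Qed.

Lemma schouten_variation_sym x : V x -> (schouten_variation x)^T = schouten_variation x.
Proof.
move=> Vx; rewrite /schouten_variation !linearB /= linearD /= linearZ /= trmx1.
by rewrite !trmx_mul !trmxK (hess_sym oV sphi Vx) [X in X - _ - _]addrC.
Qed.

Let e N x := expR (- (2 * N.+1%:R * s x)).

Lemma mx_partial_alpha N k x : V x -> mx_partial k (alpha s N) x =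
  e N x *: dalpha (flat_schouten s x) (cotton^~ x) (ext_diff s x) N k.
Proof.
move=> Vx; rewrite /alpha.
have sP := smooth_flat_schouten oV ss.
rewrite (mx_partialZ k Vx (smooth_alpha_exp oV ss N) (smooth_mxX oV N sP)).
rewrite (mx_partialX oV k Vx N sP).
rewrite (@dpow_flat R n _ (cotton^~ x) (ext_diff s x) N k); last first.
  by rewrite /cotton addrAC addrK subrK.
have c2 : smooth_on V (fun y => 2 * N.+1%:R * s y).
  by apply: smoothM => //; exact: smooth_cst.
rewrite partial_exp ?partialN; last 2 first.
- exact: smooth_diff c2 Vx.
- exact: smooth_diff (smoothN oV c2) Vx.
have -> : partial k (fun y => 2 * N.+1%:R * s y) x = 2 * N.+1%:R * partial k s x.
  move: (2 * N.+1%:R) => c; rewrite partialM ?partial_cst ?mul0r ?add0r //.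
  exact: smooth_diff ss Vx.
rewrite -scalerA -scalerDr; congr (_ *: _).
have -> : partial k s x = ext_diff s x 0 k by rewrite mxE.
rewrite /dalpha -[N.+1%:R]natr1.
have D (A B F : 'M[R]_n) (c r : R) :
    - (2 * (r + 1) * c) *: F + (A + (2 * r * c) *: F - B) = A - (2 * c) *: F - B.
  by apply/matrixP => i j; rewrite !mxE; ring.
exact: D.
Qed.

Lemma jac_multiplier N x : V x ->
  jac (fun y => ext_diff phi y *m alpha s N y) x =
  e N x *: jac_alpha (flat_schouten s x) (schouten_variation x) (cotton^~ x)
             (ext_diff s x) (ext_diff phi x) N.
Proof.
move=> Vx; apply/matrixP => k j; rewrite jacE.
rewrite (mx_partialM oV k Vx (smooth_ext_diff oV sphi) (smooth_alpha oV ss N)).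
rewrite mx_partial_alpha // mx_partial_ext_diff /alpha -!scalemxAr -scalerDr.
rewrite [LHS]mxE [RHS]mxE; congr (_ * _); rewrite /jac_alpha.
have -> : (ext_diff phi x)^T *m ext_diff s x + (ext_diff s x)^T *m ext_diff phi x
   - dotr (ext_diff s x) (ext_diff phi x) *: 1%:M - schouten_variation x = hess phi x.
  by rewrite /schouten_variation opprB addrC subrK.
rewrite [LHS]mxE [RHS]mxE; congr (_ + _); last by rewrite [RHS]mxE.
by rewrite -mulmxA -rowE mxE.
Qed.

Lemma lie_multiplier L N x : V x ->
  lie (fun y => ext_diff phi y *m alpha s N y) (alpha s L) x =
  (e N x * e L x) *: lie_alpha (flat_schouten s x) (schouten_variation x)
             (cotton^~ x) (ext_diff s x) (ext_diff phi x) L N.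
Proof.
move=> Vx; rewrite /lie jac_multiplier //.
have aE K : alpha s K x = e K x *: flat_schouten s x ^+ K by [].
have D (A J : 'M[R]_n) (a b : R) : (b *: A) *m (a *: J) + (a *: J)^T *m (b *: A) =
    (a * b) *: (A *m J + J^T *m A).
  have -> : (a *: J)^T = a *: J^T by rewrite linearZ.
  by rewrite -!scalemxAl -!scalemxAr !scalerA scalerDr [b * a]mulrC.
rewrite (aE L) D /lie_alpha scalerBr; congr (_ - _).
rewrite scaler_sumr; apply: eq_bigr => k _.
rewrite mx_partial_alpha // aE -scalemxAr [X in X *: _]mxE !scalerA.
by congr (_ *: _); rewrite mulrAC.
Qed.

(** Summing over the pairs of exponents, only the variation of the powers of
    the Schouten tensor survives. *)
Lemma sum_lie_multiplier M x : V x ->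
  \sum_(L < M) L.+1%:R *:
    lie (fun y => ext_diff phi y *m alpha s (M.-1 - L) y) (alpha s L) x =
  (expR (- (2 * M.+1%:R * s x)) * M.+1%:R) *:
    \sum_(L < M) flat_schouten s x ^+ L *m schouten_variation x
                 *m flat_schouten s x ^+ (M.-1 - L).
Proof.
move=> Vx; have Ps := flat_schouten_sym oV ss Vx.
have Qs := schouten_variation_sym Vx.
have Cs k := cotton_sym k Vx.
have Cc k i j := cotton_codazzi k i j Vx.
rewrite -scalerA -(sum_lie_alpha (ext_diff s x) (ext_diff phi x) Ps Qs Cs Cc M).
rewrite scaler_sumr; apply: eq_bigr => L _.
rewrite lie_multiplier // !scalerA; congr (_ *: _).
rewrite [RHS]mulrC; congr (_ * _); rewrite /e -expRD; congr expR.
have -> : M.+1%:R = (M.-1 - L).+1%:R + L.+1%:R :> R.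
  by rewrite -natrD; congr (_%:R); have := ltn_ord L; lia.
ring.
Qed.

End LieDerivatives.

(** * Differentiation in the conformal parameter *)

Section Jets.
Variables (R : realType) (n : nat) (V : set 'rV[R]_n).
Hypothesis oV : open V.

(** [A1] is the derivative at parameter [0] of the family [A] of matrix fields,
    and this derivative may be taken before or after a partial derivative. *)
Definition jet p q (A : R -> 'rV[R]_n -> 'M[R]_(p, q))
    (A1 : 'rV[R]_n -> 'M[R]_(p, q)) : Prop :=
  [/\ forall t, smooth_mx V (A t), smooth_mx V A1 &
    forall x, V x -> forall i j,
      is_derive (0 : R) 1 (fun t => A t x i j) (A1 x i j) /\
      forall k, is_derive (0 : R) 1 (fun t => mx_partial k (A t) x i j)
                                    (mx_partial k A1 x i j)].

Lemma is_derive_bigsum m (f : 'I_m -> R -> R) (df : 'I_m -> R) (x : R) :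
  (forall k, is_derive x 1 (f k) (df k)) ->
  is_derive x 1 (fun t => \sum_k f k t) (\sum_k df k).
Proof.
move=> dfk; have -> : (fun t => \sum_k f k t) = \sum_k f k.
  by apply/funext => t; rewrite fct_sumE.
exact: is_derive_sum.
Qed.

Lemma is_derive_add (f g : R -> R) (df dg x : R) :
  is_derive x 1 f df -> is_derive x 1 g dg ->
  is_derive x 1 (fun t => f t + g t) (df + dg).
Proof. exact: is_deriveD. Qed.

Lemma is_derive_mul (f g : R -> R) (df dg x : R) :
  is_derive x 1 f df -> is_derive x 1 g dg ->
  is_derive x 1 (fun t => f t * g t) (df * g x + f x * dg).
Proof.
move=> hf hg; apply: (is_derive_eq (is_deriveM hf hg)).
by rewrite addrC [df * _]mulrC.
Qed.

Lemma is_derive_mulmx p q r (A : R -> 'M[R]_(p, q)) (B : R -> 'M[R]_(q, r))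
    (A1 : 'M[R]_(p, q)) (B1 : 'M[R]_(q, r)) (x : R) :
  (forall i j, is_derive x 1 (fun t => A t i j) (A1 i j)) ->
  (forall i j, is_derive x 1 (fun t => B t i j) (B1 i j)) ->
  forall i j, is_derive x 1 (fun t => (A t *m B t) i j) ((A1 *m B x + A x *m B1) i j).
Proof.
move=> dA dB i j.
have -> : (fun t => (A t *m B t) i j) = (fun t => \sum_k A t i k * B t k j).
  by apply/funext => t; rewrite mxE.
have -> : (A1 *m B x + A x *m B1) i j =
    \sum_k (A1 i k * B x k j + A x i k * B1 k j).
  by rewrite big_split !mxE.
apply: is_derive_bigsum => k; exact: is_derive_mul.
Qed.

Lemma is_derive_addmx p q (A B : R -> 'M[R]_(p, q)) (A1 B1 : 'M[R]_(p, q)) (x : R) :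
  (forall i j, is_derive x 1 (fun t => A t i j) (A1 i j)) ->
  (forall i j, is_derive x 1 (fun t => B t i j) (B1 i j)) ->
  forall i j, is_derive x 1 (fun t => (A t + B t) i j) ((A1 + B1) i j).
Proof.
move=> dA dB i j.
have -> : (fun t => (A t + B t) i j) = (fun t => A t i j) + (fun t => B t i j).
  by apply/funext => t; rewrite mxE.
by rewrite mxE; exact: is_deriveD.
Qed.

Lemma jet_ext p q (A B : R -> 'rV[R]_n -> 'M[R]_(p, q)) A1 :
  (forall t x, V x -> A t x = B t x) -> jet A A1 -> jet B A1.
Proof.
move=> AB [sA sA1 dA]; split=> //.
  by move=> t; apply: (smooth_mx_ext oV (AB t)).
move=> x Vx i j; have [d0 dk] := dA x Vx i j; split.
  by rewrite (_ : (fun t => B t x i j) = (fun t => A t x i j)) //;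
    apply/funext => t; rewrite AB.
move=> k; rewrite (_ : (fun t => mx_partial k (B t) x i j) =
  (fun t => mx_partial k (A t) x i j)) //.
by apply/funext => t; rewrite (mx_partial_ext oV k Vx (AB t)).
Qed.

Lemma jet_cst p q (A : 'rV[R]_n -> 'M[R]_(p, q)) :
  smooth_mx V A -> jet (fun=> A) (fun=> 0).
Proof.
move=> sA; split=> //; first exact: smooth_mx_cst.
move=> x Vx i j; split.
  by rewrite mxE; exact: is_derive_cst.
move=> k; have -> : mx_partial k (fun=> 0 : 'M[R]_(p, q)) x i j = 0.
  by rewrite mx_partial_cst mxE.
exact: is_derive_cst.
Qed.

Lemma jetM p q r (A : R -> 'rV[R]_n -> 'M[R]_(p, q)) A1
    (B : R -> 'rV[R]_n -> 'M[R]_(q, r)) B1 :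
  jet A A1 -> jet B B1 ->
  jet (fun t y => A t y *m B t y) (fun y => A1 y *m B 0 y + A 0 y *m B1 y).
Proof.
move=> [sA sA1 dA] [sB sB1 dB]; split.
- by move=> t; exact: smooth_mxM.
- by apply: smooth_mxD => //; exact: smooth_mxM.
move=> x Vx i j; split.
  by apply: is_derive_mulmx => a b; [case: (dA x Vx a b)|case: (dB x Vx a b)].
move=> k.
have -> : (fun t => mx_partial k (fun y => A t y *m B t y) x i j) =
    (fun t => (mx_partial k (A t) x *m B t x + A t x *m mx_partial k (B t) x) i j).
  by apply/funext => t; rewrite (mx_partialM oV k Vx (sA t) (sB t)).
have -> : mx_partial k (fun y => A1 y *m B 0 y + A 0 y *m B1 y) x =
    mx_partial k A1 x *m B 0 x + mx_partial k (A 0) x *m B1 x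
    + (A1 x *m mx_partial k (B 0) x + A 0 x *m mx_partial k B1 x).
  rewrite (mx_partialD k Vx (smooth_mxM oV sA1 (sB 0)) (smooth_mxM oV (sA 0) sB1)).
  rewrite (mx_partialM oV k Vx sA1 (sB 0)) (mx_partialM oV k Vx (sA 0) sB1).
  by rewrite addrACA.
by apply: is_derive_addmx => a b; apply: is_derive_mulmx => c d;
  (case: (dA x Vx c d) || case: (dB x Vx c d)).
Qed.

Lemma jetX p (A : R -> 'rV[R]_n -> 'M[R]_p) A1 N : jet A A1 ->
  jet (fun t y => A t y ^+ N)
      (fun y => \sum_(a < N) A 0 y ^+ a *m A1 y *m A 0 y ^+ (N.-1 - a)).
Proof.
move=> jA; elim: N => [|N IH].
  rewrite (_ : (fun y => \sum_(a < 0) _) = (fun=> 0)).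
    exact/jet_cst/smooth_mx_cst.
  by apply/funext => y; rewrite big_ord0.
have := jetM jA IH.
rewrite (_ : (fun y => _ + _) = (fun y => \sum_(a < N.+1) A 0 y ^+ a *m A1 y
                                  *m A 0 y ^+ (N.+1.-1 - a))).
  by apply: jet_ext => t x _; rewrite exprS.
apply/funext => y; rewrite big_ord_recl /= subn0 expr0 mul1mx; congr (_ + _).
rewrite mulmx_sumr; apply: eq_bigr => a _.
have -> : A 0 y ^+ lift ord0 a = A 0 y *m A 0 y ^+ a by rewrite lift0 exprS.
rewrite !mulmxA; congr (_ *m _ ^+ _).
by rewrite /bump leq0n -subn1 -subnDA.
Qed.

Lemma jet_quadratic p q (P Q Z : 'rV[R]_n -> 'M[R]_(p, q)) :
  smooth_mx V P -> smooth_mx V Q -> smooth_mx V Z ->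
  jet (fun t y => P y + t *: Q y + t ^+ 2 *: Z y) Q.
Proof.
move=> sP sQ sZ.
have sc c A : smooth_mx V A -> smooth_mx V (fun y => c *: A y : 'M[R]_(p, q)).
  by move=> sA; apply: (smooth_mxZ oV (smooth_cst oV c) sA).
have quad (a b c : R) : is_derive (0 : R) 1 (fun t => a + t * b + t ^+ 2 * c) b.
  have -> : (fun t : R => a + t * b + t ^+ 2 * c) =
      (fun t => a + (t * b + t * (t * c))) by apply/funext => t; ring.
  have dt : is_derive (0 : R) 1 (fun t : R => t) 1 by exact: is_derive_id.
  have dc (r : R) : is_derive (0 : R) 1 (fun=> r) 0 by exact: is_derive_cst.
  have h1 := is_derive_mul dt (dc b).
  have h2 := is_derive_mul dt (is_derive_mul dt (dc c)).
  apply: (is_derive_eq (is_derive_add (dc a) (is_derive_add h1 h2))).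
  by rewrite !mul1r !mul0r !(mulr0, addr0) add0r.
split=> // [t|x Vx i j]; first by do !apply: smooth_mxD => //; exact: sc.
split.
  rewrite (_ : (fun t => _) = (fun t => P x i j + t * Q x i j + t ^+ 2 * Z x i j)) //.
  by apply/funext => t; rewrite !mxE.
move=> k; rewrite (_ : (fun t => _) = (fun t => mx_partial k P x i j
  + t * mx_partial k Q x i j + t ^+ 2 * mx_partial k Z x i j)) //.
apply/funext => t.
rewrite (mx_partialD k Vx (smooth_mxD oV sP (sc t Q sQ)) (sc _ Z sZ)).
rewrite (mx_partialD k Vx sP (sc t Q sQ)).
rewrite (mx_partialZ k Vx (smooth_cst oV t) sQ).
rewrite (mx_partialZ k Vx (smooth_cst oV (t ^+ 2)) sZ).
rewrite !partial_cst !scale0r !add0r.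
have E (A B C : 'M[R]_(p, q)) (a b : R) :
  (A + a *: B + b *: C) i j = A i j + a * B i j + b * C i j by rewrite !mxE.
exact: E.
Qed.

End Jets.

Section FlatTheorem.
Variables (R : realType) (n : nat) (V : set 'rV[R]_n).
Variables (s phi : 'rV[R]_n -> R).
Hypotheses (oV : open V) (ss : smooth_on V s) (sphi : smooth_on V phi).

Let st t y := s y + t * phi y.

Lemma smooth_deformed t : smooth_on V (st t).
Proof. by apply: smoothD => //; apply: smoothM => //; exact: smooth_cst. Qed.

Let ext_diff_deformed t x : V x ->
  ext_diff (st t) x = ext_diff s x + t *: ext_diff phi x.
Proof.
move=> Vx; have sc : smooth_on V (fun=> t) by exact: smooth_cst.
rewrite (ext_diffD ss (smoothM oV sc sphi) Vx) (ext_diffM sc sphi Vx).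
by rewrite ext_diff_cst scaler0 addr0.
Qed.

Lemma flat_schouten_deformed t x : V x ->
  flat_schouten (st t) x = flat_schouten s x + t *: schouten_variation s phi x
    + t ^+ 2 *: ((ext_diff phi x)^T *m ext_diff phi x
                 - (2^-1 * dotr (ext_diff phi x) (ext_diff phi x)) *: 1%:M).
Proof.
move=> Vx; rewrite /flat_schouten /schouten_variation ext_diff_deformed //.
have -> : hess (st t) x = hess s x + t *: hess phi x.
  have sd := smooth_ext_diff oV sphi.
  apply/row_matrixP => k; rewrite rowE -mx_partial_ext_diff.
  rewrite (mx_partial_ext oV k Vx (ext_diff_deformed t)).
  have sc : smooth_mx V (fun y => t *: ext_diff phi y).
    exact: (smooth_mxZ oV (smooth_cst oV t) sd).
  rewrite (mx_partialD k Vx (smooth_ext_diff oV ss) sc).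
  rewrite (mx_partialZ k Vx (smooth_cst oV t) sd) partial_cst scale0r add0r.
  by rewrite !mx_partial_ext_diff rowE mulmxDr -scalemxAr.
set d := ext_diff s x; set v := ext_diff phi x.
have -> : dotr (d + t *: v) (d + t *: v) =
    dotr d d + 2 * t * dotr d v + t ^+ 2 * dotr v v.
  rewrite dotrDr dotrZr [dotr (_ + _) d]dotrC [dotr (_ + _) v]dotrC !dotrDr !dotrZr.
  rewrite [dotr v d]dotrC; ring.
have -> : (d + t *: v)^T = d^T + t *: v^T by rewrite linearD /= linearZ.
rewrite !(mulmxDl, mulmxDr) -!scalemxAl -!scalemxAr -scalemx1.
rewrite -[(2^-1 * dotr d d)%:M]scalemx1.
move: (d^T *m d) (d^T *m v) (v^T *m d) (v^T *m v) (hess s x) (hess phi x).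
move: (dotr d d) (dotr d v) (dotr v v) => a b c A B D E F G.
by apply/matrixP => i j; rewrite !mxE; field.
Qed.

Lemma jet_flat_schouten :
  jet V (fun t => flat_schouten (st t)) (schouten_variation s phi).
Proof.
have sd := smooth_ext_diff oV ss; have sv := smooth_ext_diff oV sphi.
have so a b : smooth_mx V a -> smooth_mx V b ->
    smooth_mx V (fun y => (a y : 'rV[R]_n)^T *m (b y : 'rV[R]_n)).
  by move=> sa sb; apply: smooth_mxM => //; exact: smooth_mx_tr.
have s1 f : smooth_on V f -> smooth_mx V (fun y => f y *: (1%:M : 'M[R]_n)).
  by move=> sf; apply: (smooth_mxZ oV sf (smooth_mx_cst oV _)).
have sN p q (A : 'rV[R]_n -> 'M[R]_(p, q)) : smooth_mx V A -> smooth_mx V (fun y => - A y).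
  exact: smooth_mxN.
apply: (jet_ext oV (A := fun t y => flat_schouten s y
    + t *: schouten_variation s phi y + t ^+ 2 *: _)).
  by move=> t x Vx; rewrite flat_schouten_deformed.
apply: (jet_quadratic oV).
- exact: smooth_flat_schouten.
- apply: smooth_mxD => //; last exact/sN/smooth_hess.
  apply: smooth_mxD => //; last exact/sN/s1/smooth_dotr.
  by apply: smooth_mxD => //; exact: so.
- apply: smooth_mxD => //; first exact: so.
  apply/sN/s1/smoothM => //; first exact: smooth_cst.
  exact: smooth_dotr.
Qed.

(** The derivative at [t = 0] of [flat_schouten (s + t * phi) ^+ M]. *)
Definition power_variation M x : 'M[R]_n :=
  \sum_(a < M) flat_schouten s x ^+ a *m schouten_variation s phi x
               *m flat_schouten s x ^+ (M.-1 - a).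

Let st0 : st 0 = s.
Proof. by apply/funext => y; rewrite /st mul0r addr0. Qed.

Lemma jet_flux M u : smooth_on V u ->
  jet V (fun t y => ext_diff u y *m flat_schouten (st t) y ^+ M)
        (fun y => ext_diff u y *m power_variation M y).
Proof.
move=> su.
have := jetM oV (jet_cst oV (smooth_ext_diff oV su)) (jetX oV M jet_flat_schouten).
rewrite (_ : (fun y => _ + _) = (fun y => ext_diff u y *m power_variation M y)) //.
by apply/funext => y; rewrite mul0mx add0r /power_variation st0.
Qed.

Lemma is_derive_flux M u x : smooth_on V u -> V x ->
  is_derive (0 : R) 1
    (fun t => \tr (jac (fun y => ext_diff u y *m flat_schouten (st t) y ^+ M) x))
    (\tr (jac (fun y => ext_diff u y *m power_variation M y) x)).
Proof.
move=> su Vx; have [_ _ dF] := jet_flux M su.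
apply: is_derive_bigsum => i; rewrite jacE.
rewrite (_ : (fun t => _) = (fun t => mx_partial i
   (fun y => ext_diff u y *m flat_schouten (st t) y ^+ M) x 0 i)).
  by case: (dF x Vx 0 i).
by apply/funext => t; rewrite jacE.
Qed.

(** For the multiplier [expR (- n * s)] the weighted divergence becomes the
    Euclidean one. *)
Lemma wdiv_density (Z : 'rV[R]_n -> 'rV[R]_n) x : smooth_mx V Z -> V x ->
  wdiv s (fun y => expR (- (n%:R * s y)) *: Z y) x =
  expR (- (n%:R * s x)) * \tr (jac Z x).
Proof.
move=> sZ Vx.
have sn : smooth_on V (fun y => n%:R * s y) by apply: smoothM => //; exact: smooth_cst.
have sf : smooth_on V (fun y => expR (- (n%:R * s y))).
  by apply: smooth_exp => //; exact: smoothN.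
rewrite (wdivZ s sf sZ Vx) /wdiv /along.
have -> : ext_diff (fun y => expR (- (n%:R * s y))) x =
    (- (n%:R * expR (- (n%:R * s x)))) *: ext_diff s x.
  apply/rowP => i; rewrite [LHS]mxE [RHS]mxE [X in _ = _ * X]mxE.
  rewrite partial_exp ?partialN; last 2 first.
  - exact: smooth_diff sn Vx.
  - exact: smooth_diff (smoothN oV sn) Vx.
  have -> : partial i (fun y => n%:R * s y) x = n%:R * partial i s x.
    rewrite partialM ?partial_cst ?mul0r ?add0r //.
    exact: smooth_diff ss Vx.
  move: (expR _) (partial i s x) => a b; ring.
rewrite dotrZr [dotr (Z x) _]dotrC.
move: (expR _) (\tr _) (dotr _ _) => a b c; ring.
Qed.

Lemma wdiv_sum m (F : 'I_m -> 'rV[R]_n -> 'rV[R]_n) x :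
  (forall k, smooth_mx V (F k)) -> V x ->
  wdiv s (fun y => \sum_k F k y) x = \sum_k wdiv s (F k) x.
Proof.
move=> sF Vx; elim: (index_enum _) => [|k r IH].
  rewrite big_nil (_ : (fun _ => _) = fun=> 0) ?wdiv0 //.
  by apply/funext => y; rewrite big_nil.
rewrite big_cons -IH -(wdivD s (sF k)) //; last exact: smooth_mx_sum.
by congr (wdiv s _ x); apply/funext => y; rewrite big_cons.
Qed.

Lemma wdiv_scale c (W : 'rV[R]_n -> 'rV[R]_n) x : smooth_mx V W -> V x ->
  wdiv s (fun y => c *: W y) x = c * wdiv s W x.
Proof.
move=> sW Vx; rewrite (wdivZ s (smooth_cst oV c) sW Vx).
by rewrite /along ext_diff_cst dotrE trmx0 mulmx0 [X in _ + X]mxE addr0.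
Qed.


Lemma wlap_top M u x : n = (2 * M.+1)%N -> smooth_on V u -> V x ->
  wlap s (alpha s M) u x =
  - (expR (- (n%:R * s x)) *
     \tr (jac (fun y => ext_diff u y *m flat_schouten s y ^+ M) x)).
Proof.
move=> nM su Vx; have nR : n%:R = 2 * M.+1%:R :> R by rewrite nM natrM.
rewrite /wlap; congr (- _).
have sZ : smooth_mx V (fun y => ext_diff u y *m flat_schouten s y ^+ M).
  apply: smooth_mxM => //; first exact: smooth_ext_diff.
  exact/(smooth_mxX oV)/smooth_flat_schouten.
rewrite -(wdiv_density sZ Vx); apply: (wdiv_ext s oV Vx) => y Vy.
by rewrite /alpha -scalemxAr nR.
Qed.

(** The sum of the Lie derivatives carries the weight [M + 1], and the factor
    [2] of [double_commutator] turns it into [n]. *)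
Lemma flat_variation_formula M u x : n = (2 * M.+1)%N -> smooth_on V u -> V x ->
  n%:R * (expR (- (n%:R * s x)) *
          - \tr (jac (fun y => ext_diff u y *m power_variation M y) x)) =
  \sum_(L < M) L.+1%:R *
    (comm2 s (alpha s L) (alpha s (M.-1 - L)) phi u x
     - comm2 s (alpha s L) (alpha s (M.-1 - L)) phi (fun=> 1) x * u x).
Proof.
move=> nM su Vx; have nR : n%:R = 2 * M.+1%:R :> R by rewrite nM natrM.
have sa N := smooth_alpha oV ss N.
have asym N y (Vy : V y) := alpha_sym oV ss N Vy.
have slie (L : 'I_M) : smooth_mx V
    (lie (fun y => ext_diff phi y *m alpha s (M.-1 - L) y) (alpha s L)).
  have sW : smooth_mx V (fun y => ext_diff phi y *m alpha s (M.-1 - L) y).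
    by apply: smooth_mxM => //; exact: smooth_ext_diff.
  exact: smooth_lie.
have sY (L : 'I_M) : smooth_mx V (fun y => ext_diff u y *m
    lie (fun y => ext_diff phi y *m alpha s (M.-1 - L) y) (alpha s L) y).
  by apply: smooth_mxM => //; exact: smooth_ext_diff.
have sB : smooth_mx V (fun y => ext_diff u y *m power_variation M y).
  by case: (jet_flux M su).
transitivity (- 2 * wdiv s (fun y => \sum_(L < M) L.+1%:R *: (ext_diff u y *m
    lie (fun y => ext_diff phi y *m alpha s (M.-1 - L) y) (alpha s L) y)) x).
  have e y : V y -> \sum_(L < M) L.+1%:R *: (ext_diff u y *m
      lie (fun y => ext_diff phi y *m alpha s (M.-1 - L) y) (alpha s L) y) =
      expR (- (n%:R * s y)) *: (M.+1%:R *: (ext_diff u y *m power_variation M y)).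
    move=> Vy; rewrite scalerA scalemxAr nR.
    rewrite -(sum_lie_multiplier oV ss sphi M Vy) mulmx_sumr.
    by apply: eq_bigr => L _; rewrite scalemxAr.
  have sMB : smooth_mx V (fun y => M.+1%:R *: (ext_diff u y *m power_variation M y)).
    exact: (smooth_mxZ oV (smooth_cst oV _) sB).
  rewrite (wdiv_ext s oV Vx e) (wdiv_density sMB Vx).
  have -> : \tr (jac (fun y => M.+1%:R *: (ext_diff u y *m power_variation M y)) x) =
      M.+1%:R * \tr (jac (fun y => ext_diff u y *m power_variation M y) x).
    rewrite -mxtraceZ; congr (\tr _); apply/matrixP => k j.
    rewrite jacE (mx_partialZ k Vx (smooth_cst oV _) sB) partial_cst scale0r add0r.
    by rewrite [LHS]mxE [RHS]mxE jacE.
  rewrite [X in X * _ = _]nR.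
  move: (M.+1%:R) (expR _) (\tr _) => a b c; ring.
rewrite wdiv_sum //; last by move=> L; exact: (smooth_mxZ oV (smooth_cst oV _) (sY L)).
rewrite mulr_sumr; apply: eq_bigr => L _.
rewrite wdiv_scale // (double_commutator oV ss (sa L) (sa _) (asym L) (asym _) sphi su Vx).
by rewrite mulrCA.
Qed.

End FlatTheorem.

(** * From a flat chart to the manifold *)

Section Charts.
Variables (R : realType) (M : topologicalType) (n : nat).
Implicit Types c : chart R M n.

Lemma open_overlap c c' : open (overlap c c').
Proof.
rewrite openE => y [iy dy]; rewrite /interior.
have h1 : nbhs y (img c) by apply: open_nbhs_nbhs; split=> //; exact: img_open.
have h2 : nbhs y (param c @^-1` dom c').
  apply: (param_cont iy); apply: open_nbhs_nbhs; split=> //; exact: dom_open.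
exact: filterI h1 h2.
Qed.

Lemma overlap_transition c c' y : overlap c c' y -> overlap c' c (transition c c' y).
Proof.
move=> [iy dy]; split; first exact: coord_img.
by rewrite /transition coordK //; exact: param_dom.
Qed.

Lemma param_transition c c' y : overlap c c' y ->
  param c' (transition c c' y) = param c y.
Proof. by move=> [iy dy]; rewrite /transition coordK. Qed.

Lemma transitionK c c' y : overlap c c' y ->
  transition c' c (transition c c' y) = y.
Proof. by move=> o; rewrite {1}/transition param_transition //; case: o => ? _; exact: paramK. Qed.

Lemma jacobianE (psi : 'rV[R]_n -> 'rV[R]_n) y i a :
  (forall k, differentiable (fun z => psi z 0 k) y) ->
  ('J psi y) i a = partial i (fun z => psi z 0 a) y.
Proof.
move=> dpsi; have dp := differentiable_components dpsi.
have := deriveEjacobian (delta_mx 0 i) dp; rewrite -rowE => /rowP /(_ a).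
rewrite [RHS]mxE => <-; rewrite derive_mx; last exact: diff_derivable.
by rewrite mxE.
Qed.

Lemma partial_coord (i k : 'I_n) (y : 'rV[R]_n) :
  partial i (fun z => z 0 k) y = (i == k)%:R.
Proof.
have /derive_mx : derivable (id : 'rV[R]_n -> 'rV[R]_n) y (delta_mx 0 i).
  exact: derivable_id.
rewrite derive_id => /rowP /(_ k); rewrite mxE eqxx eq_sym => ->.
by rewrite mxE.
Qed.

Variable S : smoothStructure R M n.

Lemma chart_atP p : atlas S (chart_at S p) /\ dom (chart_at S p) p.
Proof. exact: projT2 (cid (atlas_cover S p)). Qed.

(** Invariance under coordinate changes replaces the chart chosen at each point
    by a single chart in which the metric is conformal to the Euclidean one. *)
Lemma T_op_flat (hn : (2 < n)%N) (G : metric R M n) (c' : chart R M n) s N v y :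
  atlas S c' -> smooth_on (img c') s ->
  (forall c, atlas S c -> forall z, overlap c c' z ->
     G c z = 'J (transition c c') z *m flat_metric s (transition c c' z)
             *m ('J (transition c c') z)^T) ->
  smooth_on (img c') (fun z => v (param c' z)) -> img c' y ->
  T_op S N G v (param c' y) = wlap s (alpha s N) (fun z => v (param c' z)) y.
Proof.
move=> ac' ss tG sv Vy; rewrite /T_op.
have [ac dc] := chart_atP (param c' y).
set c := chart_at S (param c' y) in ac dc *.
have Uy : overlap c c' (Defs.coord c (param c' y)).
  split; first exact: coord_img.
  by rewrite coordK //; exact: param_dom.
have oU : open (overlap c c') by exact: open_overlap.
have oU' : open (overlap c' c) by exact: open_overlap.
have oV : open (img c') by exact: img_open.
have spsi k : smooth_on (overlap c c') (fun z => transition c c' z 0 k).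
  by case: (atlas_compatible ac ac' k).
have spsi' k : smooth_on (overlap c' c) (fun z => transition c' c z 0 k).
  by case: (atlas_compatible ac ac' k).
have UU' z (Uz : overlap c c' z) := overlap_transition Uz.
have UV z : overlap c c' z -> img c' (transition c c' z) by move=> /UU' [].
have JE z i a : overlap c c' z ->
    ('J (transition c c') z) i a = partial i (fun t => transition c c' t 0 a) z.
  by move=> Uz; apply: jacobianE => k; exact: smooth_diff (spsi k) Uz.
have JE' z i a : overlap c' c z ->
    ('J (transition c' c) z) i a = partial i (fun t => transition c' c t 0 a) z.
  by move=> Uz; apply: jacobianE => k; exact: smooth_diff (spsi' k) Uz.
pose K z := 'J (transition c' c) (transition c c' z).
have sK : smooth_mx (overlap c c') K.
  apply: (smooth_mx_comp oU UU' spsi (A := fun z => 'J (transition c' c) z)).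
  move=> i a; apply: (smooth_ext oU' _ (smooth_partial i (spsi' a))) => z Uz.
  by rewrite JE'.
have JK z : overlap c c' z -> 'J (transition c c') z *m K z = 1%:M.
  move=> Uz; apply/matrixP => i k; rewrite [LHS]mxE [RHS]mxE.
  rewrite -(partial_coord i k z).
  have e t : overlap c c' t -> t 0 k = transition c' c (transition c c' t) 0 k.
    by move=> Ut; rewrite transitionK.
  rewrite (partial_ext i oU e Uz).
  rewrite (@partial_comp R n n i (transition c c') (fun t => transition c' c t 0 k)).
  - apply: eq_bigr => a _.
    exact: (congr2 *%R (JE z i a Uz) (JE' _ a k (UU' z Uz))).
  - by move=> a; exact: smooth_diff (spsi a) Uz.
  - exact: smooth_diff (spsi' k) (UU' _ Uz).
have ty : transition c c' (Defs.coord c (param c' y)) = y.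
  by rewrite /transition coordK // paramK.
rewrite -(flat_T_op oV ss hn N sv Vy) -[in RHS]ty.
apply: (local_T_op_change oU oV UV spsi JE JK sK _ _ _ _ (tG c ac) (u' := fun z => v (param c' z))) => //.
- exact: smooth_flat_metric.
- by move=> z _; exact: flat_metric_sym.
- by move=> z _; exact: flat_metric_unit.
- by move=> i; exact: smooth_flat_conn.
- exact: smooth_ext_diff.
- exact: smooth_flat_hash.
- by move=> z Uz; rewrite param_transition.
Qed.

End Charts.

Theorem theorem3p2 (R : realType) (n : nat) (hn : (4 <= n)%N)
  (hev : ~~ odd n) (M : topologicalType) (hT2 : hausdorff_space M)
  (hsc : @second_countable M) (S : smoothStructure R M n) (g : metric R M n)
  (hg : riemannian S g) (hflat : locally_conformally_flat S g)
  (phi : M -> R) (hphi : smooth S phi) (u : M -> R) (hu : smooth S u) (x : M) :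
  let F (t : R) : R :=
    expR (n%:R * t * phi x) *
    T_op S (n./2 - 1) (conformal_change (fun p => t * phi p) g) u x in
  derivable F 0 1 /\
  n%:R * derive1 F 0 =
  \sum_(1 <= j < n./2)
    j%:R * nonconst_op
             (comm_op (T_op S (j - 1) g)
                (comm_op (T_op S (n./2 - 1 - j) g) (mul_op phi))) u x.
Proof.
move=> F.
have hn2 : (2 < n)%N by apply: leq_trans hn.
have [c' [ac' dx [s [ss gE]]]] := hflat x.
set V := img c'; have oV : open V by exact: img_open.
have sph : smooth_on V (fun z => phi (param c' z)) by exact: hphi.
have su : smooth_on V (fun z => u (param c' z)) by exact: hu.
set ph := (fun z => phi (param c' z)) in sph.
set u' := (fun z => u (param c' z)) in su.
pose y := Defs.coord c' x.
have Vy : V y by exact: coord_img.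
have xE : x = param c' y by rewrite /y coordK.
have [m nm] : exists m, n = (2 * m.+1)%N.
  exists n./2.-1; have := odd_double_half n; rewrite (negbTE hev) add0n -mul2n.
  by case: (n./2) => [|k] e //; rewrite -e // in hn.
have nhalf : n./2 = m.+1 by rewrite nm mul2n doubleK.
have Tt t N v z : smooth_on V (fun z => v (param c' z)) -> V z ->
    T_op S N (conformal_change (fun p => t * phi p) g) v (param c' z) =
    wlap (fun z => s z + t * ph z) (alpha (fun z => s z + t * ph z) N)
       (fun z => v (param c' z)) z.
  move=> sv Vz; apply: (T_op_flat hn2 N ac') => //; first exact: smooth_deformed.
  move=> c ac w ow; rewrite /conformal_change (metric_transition hg ac ac' ow) gE.
    rewrite /flat_metric -!scalemxAr -!scalemxAl scalerA -expRD.
    by rewrite mulrDr addrC /ph param_transition.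
  by case: (overlap_transition ow).
have T0 N v z : smooth_on V (fun z => v (param c' z)) -> V z ->
    T_op S N g v (param c' z) = wlap s (alpha s N) (fun z => v (param c' z)) z.
  move=> sv Vz; apply: (T_op_flat hn2 N ac') => //.
  move=> c ac w ow; rewrite (metric_transition hg ac ac' ow) gE //.
  by case: (overlap_transition ow).
(* The factor [expR (n * t * phi)] removes [t] from the exponent left over by
   [wlap_top]: up to a constant, [F] is polynomial in [t]. *)
have FE : F = (fun t => expR (- (n%:R * s y)) *
    - \tr (jac (fun z => ext_diff u' z *m
                 flat_schouten (fun z => s z + t * ph z) z ^+ m) y)).
  apply/funext => t; rewrite /F nhalf subn1 /= {2}xE Tt //.
  rewrite (wlap_top oV (smooth_deformed oV ss sph t) nm su Vy).
  rewrite mulrN mulrA -expRD mulrN; congr (- (expR _ * _)).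
  rewrite xE -/(ph y); ring.
have dF : is_derive (0 : R) 1 F (expR (- (n%:R * s y)) *
    - \tr (jac (fun z => ext_diff u' z *m power_variation s ph m z) y)).
  rewrite FE.
  have h := is_deriveN (is_derive_flux oV ss sph m su Vy).
  apply: (is_derive_eq (is_derive_mul (is_derive_cst _ _ _) h)).
  by rewrite mul0r add0r.
split; first by case: dF.
rewrite derive1E (@derive_val _ _ _ _ _ _ _ dF) (flat_variation_formula oV ss sph nm su Vy).
rewrite nhalf big_add1 /= big_mkord; apply: eq_bigr => L _.
rewrite !subn1 /= -subn1 -subnDA add1n; congr (_ * _).
have -> : (m - L.+1)%N = (m.-1 - L)%N by have := ltn_ord L; lia.
set N := (m.-1 - L)%N.
have sa K := smooth_alpha oV ss K.
have C v : smooth_on V (fun z => v (param c' z)) ->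
    comm_op (T_op S L g) (comm_op (T_op S N g) (mul_op phi)) v (param c' y) =
    comm2 s (alpha s L) (alpha s N) ph (fun z => v (param c' z)) y.
  move=> sv; set v' := (fun z => v (param c' z)) in sv *.
  have B w z : smooth_on V (fun z => w (param c' z)) -> V z ->
      comm_op (T_op S N g) (mul_op phi) w (param c' z) =
      comm1 s (alpha s N) ph (fun z => w (param c' z)) z.
    move=> sw Vz; rewrite /comm_op /mul_op /comm1 !T0 //.
    exact: (smoothM oV sph sw).
  have sB : smooth_on V (comm1 s (alpha s N) ph v').
    apply: smoothB => //; first by apply: smooth_wlap => //; exact: smoothM.
    by apply: smoothM => //; exact: smooth_wlap.
  have sA : smooth_on V (fun z => T_op S L g v (param c' z)).
    apply: (smooth_ext oV _ (smooth_wlap oV ss (sa L) sv)) => z Vz.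
    by rewrite T0.
  have sB' : smooth_on V (fun z =>
      comm_op (T_op S N g) (mul_op phi) v (param c' z)).
    by apply: (smooth_ext oV _ sB) => z Vz; rewrite B.
  apply: (congr2 (fun a b => a - b)).
    apply: (etrans (T0 L _ y sB' Vy)); apply: (wlap_ext s oV _ Vy) => z Vz.
    exact: B.
  apply: (etrans (B _ y sA Vy)).
  apply: (congr2 (fun a b => a - ph y * b)); apply: (wlap_ext s oV _ Vy) => z Vz.
    by apply: congr1; exact: T0.
  exact: T0.
rewrite /nonconst_op xE !C //; exact: smooth_cst.
Qed.
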